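(* Let $\mathcal{A}$ be a finite von Neumann factor, $\tilde p_0=\begin{pmatrix}1&0\\0&0\end{pmatrix}\in M_2(\mathcal{A})$, and let $\mathcal{R}$ be the Riemann sphere of $\mathcal{A}$, i.e. the unitary orbit of $\tilde p_0$ in $M_2(\mathcal{A})$. Then the set $\{\tilde q\in M_2(\mathcal{A}):\tilde q^2=\tilde q=\tilde q^*,\ \|\tilde q-\tilde p_0\|<1\}$ is dense (in the norm topology) in $\mathcal{R}$.
   Context: $\mathcal{R}=\{\tilde u\tilde p_0\tilde u^*:\tilde u\text{ unitary in }M_2(\mathcal{A})\}$. (Every projection $\tilde q$ with $\|\tilde q-\tilde p_0\|<1$ is unitarily equivalent to $\tilde p_0$ in $M_2(\mathcal{A})$, so the set in question is contained in $\mathcal{R}$.) *)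

(* Defs.v *)
From HB Require Import structures.
From mathcomp Require Import all_boot all_order all_algebra sesquilinear.
From mathcomp Require Import complex.
From mathcomp Require Import all_classical all_reals all_analysis.

Set Implicit Arguments.
Unset Strict Implicit.
Unset Printing Implicit Defensive.

Import Order.TTheory GRing.Theory Num.Theory.
Import numFieldNormedType.Exports.

Local Open Scope classical_set_scope.
Local Open Scope ring_scope.

(* Complex Hilbert spaces.  The inner product is linear in its first argument
   and conjugate-linear in the second one. *)
HB.mixin Record CompleteNormedModule_isHilbert (R : realType) H
    of CompleteNormedModule R[i] H := {
  inner : {dot H for (@Num.conj R[i])} ;
  sqr_norm_inner : forall x : H, `|x| ^+ 2 = inner x x }.

#[short(type="hilbertType")]
HB.structure Definition Hilbert (R : realType) :=
  {H of CompleteNormedModule R[i] H & CompleteNormedModule_isHilbert R H}.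

Record bop (R : realType) (H : hilbertType R) := Bop {
  bop_fun :> H -> H ;
  bop_linear : linear bop_fun ;
  bop_continuous : continuous bop_fun }.

Section BoundedOperators.
Context (R : realType) (H : hilbertType R).
Implicit Types S T U : bop H.

Lemma bopP S T : (forall x, S x = T x) -> S = T.
Proof.
case: S T => [f lf cf] [g lg cg] /= /funext fg; subst g.
by congr Bop; exact: Prop_irrelevance.
Qed.

HB.instance Definition _ := gen_eqMixin (bop H).
HB.instance Definition _ := gen_choiceMixin (bop H).

Lemma bop_raddf T : {morph T : x y / x + y}.
Proof. by move=> x y; have := bop_linear T 1 x y; rewrite !scale1r. Qed.

Lemma bop_scale T a x : T (a *: x) = a *: T x.
Proof.
have T0 : T 0 = 0 by apply: (addrI (T 0)); rewrite -bop_raddf !addr0.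
by have := bop_linear T a x 0; rewrite T0 !addr0.
Qed.

Let zero_linear : linear (fun _ : H => 0 : H).
Proof. by move=> a x y; rewrite scaler0 addr0. Qed.
Let zero_continuous : continuous (fun _ : H => 0 : H).
Proof. by move=> x; exact: cvg_cst. Qed.
Definition bop_zero := Bop zero_linear zero_continuous.

Let opp_linear T : linear (fun x => - T x).
Proof. by move=> a x y; rewrite bop_linear opprD scalerN. Qed.
Let opp_continuous T : continuous (fun x => - T x).
Proof. by move=> x; apply: cvgN; exact: bop_continuous. Qed.
Definition bop_opp T := Bop (opp_linear T) (@opp_continuous T).

Let add_linear S T : linear (fun x => S x + T x).
Proof. by move=> a x y; rewrite !bop_linear scalerDr addrACA. Qed.
Let add_continuous S T : continuous (fun x => S x + T x).
Proof. by move=> x; apply: cvgD; exact: bop_continuous. Qed.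
Definition bop_add S T := Bop (add_linear S T) (@add_continuous S T).

Let scale_linear a T : linear (fun x => a *: T x).
Proof. by move=> b x y; rewrite bop_linear scalerDr !scalerA mulrC. Qed.
Let scale_continuous a T : continuous (fun x => a *: T x).
Proof. by move=> x; apply: cvgZl_tmp; exact: bop_continuous. Qed.
Definition bop_scaling a T := Bop (scale_linear a T) (@scale_continuous a T).

Let one_linear : linear (fun x : H => x). Proof. by []. Qed.
Let one_continuous : continuous (fun x : H => x).
Proof. by move=> x; exact: cvg_id. Qed.
Definition bop_one := Bop one_linear one_continuous.

Let mul_linear S T : linear (fun x => S (T x)).
Proof. by move=> a x y; rewrite !bop_linear. Qed.
Let mul_continuous S T : continuous (fun x => S (T x)).
Proof.
by move=> x; apply: (@continuous_comp _ _ _ T S); exact: bop_continuous.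
Qed.
Definition bop_mul S T := Bop (mul_linear S T) (@mul_continuous S T).

Let bop_addA : associative bop_add.
Proof. by move=> S T U; apply: bopP => x /=; rewrite addrA. Qed.
Let bop_addC : commutative bop_add.
Proof. by move=> S T; apply: bopP => x /=; rewrite addrC. Qed.
Let bop_add0 : left_id bop_zero bop_add.
Proof. by move=> T; apply: bopP => x /=; rewrite add0r. Qed.
Let bop_addN : left_inverse bop_zero bop_opp bop_add.
Proof. by move=> T; apply: bopP => x /=; rewrite addNr. Qed.
HB.instance Definition _ :=
  GRing.isZmodule.Build (bop H) bop_addA bop_addC bop_add0 bop_addN.

Let bop_mulA : associative bop_mul.
Proof. by move=> S T U; exact: bopP. Qed.
Let bop_mul1l : left_id bop_one bop_mul.
Proof. by move=> T; exact: bopP. Qed.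
Let bop_mul1r : right_id bop_one bop_mul.
Proof. by move=> T; exact: bopP. Qed.
Let bop_mulDl : left_distributive bop_mul bop_add.
Proof. by move=> S T U; exact: bopP. Qed.
Let bop_mulDr : right_distributive bop_mul bop_add.
Proof. by move=> S T U; apply: bopP => x /=; rewrite bop_raddf. Qed.
HB.instance Definition _ := GRing.Zmodule_isPzRing.Build (bop H)
  bop_mulA bop_mul1l bop_mul1r bop_mulDl bop_mulDr.

Let bop_scaleA a b T :
  bop_scaling a (bop_scaling b T) = bop_scaling (a * b) T.
Proof. by apply: bopP => x /=; rewrite scalerA. Qed.
Let bop_scale1 : left_id 1 bop_scaling.
Proof. by move=> T; apply: bopP => x /=; rewrite scale1r. Qed.
Let bop_scaleDr : right_distributive bop_scaling +%R.
Proof. by move=> a S T; apply: bopP => x /=; rewrite scalerDr. Qed.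
Let bop_scaleDl T : {morph bop_scaling^~ T : a b / a + b}.
Proof. by move=> a b; apply: bopP => x /=; rewrite scalerDl. Qed.
HB.instance Definition _ := GRing.Zmodule_isLmodule.Build R[i] (bop H)
  bop_scaleA bop_scale1 bop_scaleDr bop_scaleDl.

(* The adjoint: the bounded operator S with <T x, y> = <x, S y>, which exists
   by the Riesz representation theorem (so the default value 0 of [xget] is
   never used) and is unique. *)
Definition adjoint T : bop H :=
  xget 0 [set S : bop H | forall x y, inner (T x) y = inner x (S y)].

Implicit Types A : set (bop H).

Definition commutant A := [set S : bop H | forall T, A T -> S * T = T * S].

Record von_neumann_algebra A : Prop := VonNeumannAlgebra {
  vN1 : A 1 ;
  vN_linear : forall a S T, A S -> A T -> A (a *: S + T) ;
  vN_mul : forall S T, A S -> A T -> A (S * T) ;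
  vN_adjoint : forall T, A T -> A (adjoint T) ;
  vN_bicommutant : commutant (commutant A) = A }.

Definition von_neumann_factor A :=
  von_neumann_algebra A /\
  A `&` commutant A = [set a *: (1 : bop H) | a in [set: R[i]]].

(* Murray-von Neumann finiteness: the projection 1 is equivalent in A to no
   proper subprojection, i.e. every isometry of A is unitary. *)
Definition finite_algebra A :=
  forall V, A V -> adjoint V * V = 1 -> V * adjoint V = 1.

Definition matrix_algebra n A : set 'M[bop H]_n := [set M | forall i j, A (M i j)].

Definition mxadjoint n (M : 'M[bop H]_n) : 'M[bop H]_n := map_mx adjoint M^T.

(* The norm of the Hilbert space direct sum of n copies of H; the norm of H has
   its values in R[i], hence the real part. *)
Definition dsnorm n (x : 'I_n -> H) : R :=
  Num.sqrt (\sum_i complex.Re `|x i| ^+ 2).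

Definition mxact n (M : 'M[bop H]_n) (x : 'I_n -> H) : 'I_n -> H :=
  fun i => \sum_j M i j (x j).

(* The C*-norm of M_n(B(H)): the operator norm on the direct sum. *)
Definition mxopnorm n (M : 'M[bop H]_n) : R :=
  sup [set dsnorm (mxact M x) | x in [set x | dsnorm x <= 1]].

Definition mxprojection n A : set 'M[bop H]_n :=
  [set q | [/\ matrix_algebra A q, q *m q = q & mxadjoint q = q]].

Definition mxunitary n A : set 'M[bop H]_n :=
  [set u | [/\ matrix_algebra A u, mxadjoint u *m u = 1%:M
             & u *m mxadjoint u = 1%:M]].

Definition p0 : 'M[bop H]_2 := delta_mx 0 0.

Definition riemann_sphere A : set 'M[bop H]_2 :=
  [set u *m p0 *m mxadjoint u | u in mxunitary A].

Definition norm_dense_in n (D X : set 'M[bop H]_n) :=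
  D `<=` X /\
  forall x, X x -> forall e : R, 0 < e -> exists2 y, D y & mxopnorm (y - x) < e.

End BoundedOperators.

Arguments p0 {R H}.

(* Main.v *)
Require Import Defs.
From mathcomp Require Import all_boot all_order all_algebra sesquilinear.
From mathcomp Require Import complex.
From mathcomp Require Import all_classical all_reals all_analysis.
From mathcomp Require Import ring lra.

(* A projection q = [[a, b], [b*, d]] with |q - p0| < 1 has a and 1 - d positive
   and invertible; with g = sqrt a and h = sqrt (1 - d) the unitary
   [[g, - b h^-1], [b* g^-1, h]] carries p0 to q.

   Conversely let the first column of a unitary be (c, s), so that
   q = (c, s) (c, s)*.  A maximal partial isometry extending the polar part of c
   is an isometry or a co-isometry, because A is a factor, hence a unitary w,
   because A is finite; so c = w |c|.  Replacing c by w (|c| + r), which is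
   bounded below, and renormalising the column gives a projection close to q at
   distance less than 1 from p0.

   Adjoints, orthogonal projections, polar parts, inverses and upper bounds of
   chains of partial isometries are all adjoints of bounded linear relations, so
   that one variational argument in the real Hilbert space (H, Re <x, y>) yields
   them all. *)

Set Implicit Arguments.
Unset Strict Implicit.
Unset Printing Implicit Defensive.

Import Order.TTheory GRing.Theory Num.Theory.
Import numFieldNormedType.Exports.

Local Open Scope classical_set_scope.
Local Open Scope ring_scope.

(** * The underlying real Hilbert space *)

Section RealInnerProduct.
Context (R : realType) (H : hilbertType R).
Implicit Types (x y z : H) (a : R[i]) (r : R).

(** Estimates and orthogonality arguments take place over [R]; nothing is lost, since [rip_inner]
    recovers the imaginary part of the inner product from [rip] at a multiple of y by the imaginary
    unit. *)
Definition rip x y : R := complex.Re (inner x y).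

Definition nrm x : R := complex.Re `|x|.

Let innerC x y : inner x y = (inner y x)^*%C.
Proof. by rewrite (hermC (inner : {dot H for Num.conj}) x y) expr0 mul1r. Qed.

Lemma ripC x y : rip x y = rip y x.
Proof. by rewrite /rip innerC; case: (inner y x). Qed.

Lemma ripDl x y z : rip (x + y) z = rip x z + rip y z.
Proof. by rewrite /rip (linearDl (inner : {dot H for Num.conj})) raddfD. Qed.

Lemma ripDr x y z : rip z (x + y) = rip z x + rip z y.
Proof. by rewrite ripC ripDl !(ripC z). Qed.

Lemma ripNl x z : rip (- x) z = - rip x z.
Proof. by rewrite /rip (linearNl (inner : {dot H for Num.conj})) raddfN. Qed.

Lemma ripNr x z : rip z (- x) = - rip z x.
Proof. by rewrite ripC ripNl ripC. Qed.

Lemma rip0l z : rip 0 z = 0.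
Proof. by rewrite -(subrr 0) ripDl ripNl subrr. Qed.

Lemma rip0r z : rip z 0 = 0.
Proof. by rewrite ripC rip0l. Qed.

Lemma inner_Zl a x y : inner (a *: x) y = a * inner x y.
Proof. by rewrite (linearZl_LR (inner : {dot H for Num.conj})). Qed.

Lemma inner_Zr a x y : inner x (a *: y) = a^*%C * inner x y.
Proof. by rewrite (linearZr_LR (inner : {dot H for Num.conj})). Qed.

Lemma ripZ_conj a x y : rip (a *: x) y = rip x (a^*%C *: y).
Proof. by rewrite /rip inner_Zl inner_Zr conjcK. Qed.

Lemma ripZl r x y : rip (r%:C%C *: x) y = r * rip x y.
Proof.
by rewrite /rip inner_Zl; case: (inner x y) => u v /=; rewrite mul0r subr0.
Qed.

Lemma ripZr r x y : rip x (r%:C%C *: y) = r * rip x y.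
Proof. by rewrite ripC ripZl ripC. Qed.

Definition ripE := (ripDl, ripDr, ripNl, ripNr, ripZl, ripZr, rip0l, rip0r).

Lemma rip_inner x y : inner x y = (rip x y +i* rip x ('i%C *: y))%C.
Proof.
rewrite {2}/rip inner_Zr /rip; case: (inner x y) => u v /=.
by rewrite !mul0r sub0r mulN1r opprK.
Qed.

Lemma normE x : `|x| = (nrm x)%:C%C.
Proof.
have := normr_ge0 x; rewrite /nrm; case: (`|x|) => u v.
by rewrite lecE /= => /andP[/eqP -> _].
Qed.

Lemma nrm_ge0 x : 0 <= nrm x.
Proof. by have := normr_ge0 x; rewrite normE ler0c. Qed.

Lemma nrm_sqr x : nrm x ^+ 2 = rip x x.
Proof.
rewrite /rip -sqr_norm_inner normE -rmorphXn /=.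
by [].
Qed.

Lemma rip_ge0 x : 0 <= rip x x.
Proof. by rewrite -nrm_sqr sqr_ge0. Qed.

Lemma nrm_eq0 x : nrm x = 0 -> x = 0.
Proof. by move=> h; apply/normr0_eq0; rewrite normE h. Qed.

Lemma rip_eq0 x : rip x x <= 0 -> x = 0.
Proof.
rewrite -nrm_sqr => h; apply: nrm_eq0; apply/eqP.
by rewrite -sqrf_eq0 eq_le h sqr_ge0.
Qed.

Lemma nrm0 : nrm (0 : H) = 0.
Proof. by rewrite /nrm normr0. Qed.

Lemma nrmN x : nrm (- x) = nrm x.
Proof. by rewrite /nrm normrN. Qed.

Lemma nrmB x y : nrm (x - y) = nrm (y - x).
Proof. by rewrite -nrmN opprB. Qed.

Lemma nrmD x y : nrm (x + y) <= nrm x + nrm y.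
Proof. by have := ler_normD x y; rewrite !normE -rmorphD /= lecR. Qed.

Lemma nrm_triangle y x z : nrm (x - z) <= nrm (x - y) + nrm (y - z).
Proof. by apply: le_trans (nrmD _ _); rewrite addrA subrK. Qed.

Lemma nrmZ a x : nrm (a *: x) = complex.Re `|a| * nrm x.
Proof.
rewrite {1}/nrm normrZ normE; have := normr_ge0 a; case: (`|a|) => u v /=.
by rewrite mulr0 subr0.
Qed.

Lemma Re_norm_real r : complex.Re `|r%:C%C| = `|r|.
Proof. by rewrite normc_def /= expr0n /= addr0 sqrtr_sqr. Qed.

Lemma nrmZr r x : nrm (r%:C%C *: x) = `|r| * nrm x.
Proof. by rewrite nrmZ Re_norm_real. Qed.

Lemma ler_nrm x y : (nrm x <= nrm y) = (rip x x <= rip y y).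
Proof. by rewrite -!nrm_sqr ler_pXn2r // nnegrE nrm_ge0. Qed.

(** Cauchy-Schwarz, obtained by squaring the triangle inequality. *)
Lemma rip_le x y : rip x y <= nrm x * nrm y.
Proof.
have h1 := nrmD x y; have h2 := nrm_ge0 (x + y).
have h3 := nrm_sqr (x + y); rewrite !ripE -!nrm_sqr (ripC y x) in h3.
have hx := nrm_ge0 x; have hy := nrm_ge0 y.
by nra.
Qed.

Lemma rip_inj x y : (forall z, rip z x = rip z y) -> x = y.
Proof.
move=> h; apply/subr0_eq/rip_eq0.
by rewrite ripDr ripNr h subrr.
Qed.

Lemma complete_seq (u : nat -> H) :
  (forall e : R, 0 < e -> exists N, forall n m, (N <= n)%N -> (N <= m)%N ->
     nrm (u n - u m) < e) ->
  exists l, forall e : R, 0 < e -> exists N, forall n, (N <= n)%N ->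
     nrm (u n - l) < e.
Proof.
move=> uC.
have : cvg (u @ \oo).
  apply: cauchy_cvg; apply/cauchy_ballP => e e0.
  have [r r0 ->] : exists2 r : R, 0 < r & e = r%:C%C.
    move: e0; rewrite ltcE; case: e => a b /= /andP[/eqP -> a0].
    by exists a.
  have [N hN] := uC _ r0.
  exists (u @` [set n | (N <= n)%N], u @` [set n | (N <= n)%N]) => /=.
    by split; exists N => // n /= hn; exists n.
  move=> [_ _] /= [[n hn <-] [m hm <-]].
  by rewrite -ball_normE /= normE ltcR; exact: hN.
move=> /cvgrPdist_lt cu; exists (lim (u @ \oo)) => e e0.
have [|N _ hN] := cu e%:C%C; first by rewrite ltcR.
by exists N => n /hN /=; rewrite normE ltcR nrmB.
Qed.

End RealInnerProduct.

(** * Boundedness, Riesz representation and adjoints of linear relations *)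

Section BoundedOperatorTheory.
Context (R : realType) (H : hilbertType R).
Implicit Types (x y z : H) (a : R[i]) (r : R) (S T X : bop H).

Lemma le_of_eps (b c d : R) : (forall e, 0 < e -> b <= c + e * d) -> b <= c.
Proof.
move=> h; apply/ler_addgt0Pr => e e0.
have d0 : 0 < `|d| + 1 by rewrite ltr_wpDl.
apply: (le_trans (h (e / (`|d| + 1)) _)); first exact: divr_gt0.
rewrite lerD2l mulrAC ler_pdivrMr // ler_pM2l //.
by apply: (le_trans (ler_norm d)); rewrite lerDl.
Qed.

Lemma rip_norm_le x y : `|rip x y| <= nrm x * nrm y.
Proof.
apply/ler_normlP; split; last exact: rip_le.
rewrite -ripNl -(nrmN x); exact: rip_le.
Qed.

Lemma bop0 T : T 0 = 0.
Proof. by rewrite -(scale0r (0 : H)) bop_scale !scale0r. Qed.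

Lemma bopN T x : T (- x) = - T x.
Proof. by rewrite -scaleN1r bop_scale scaleN1r. Qed.

Lemma bopB T x y : T (x - y) = T x - T y.
Proof. by rewrite bop_raddf bopN. Qed.

Lemma bop_bounded T : exists2 M : R, 0 <= M & forall x, nrm (T x) <= M * nrm x.
Proof.
have T0 := bop0 T.
have cT := @bop_continuous _ _ T 0.
have /nbhs_ballP[e /= e0 he] : \forall x \near (0 : H), `|T 0 - T x| < 1.
  by apply: cvgr_dist_lt => //; exact: cT.
rewrite T0 in he.
have [r r0 er] : exists2 r : R, 0 < r & e = r%:C%C.
  by move: e0; rewrite ltcE; case: e {he} => u v /= /andP[/eqP -> a0]; exists u.
have hr x : nrm x < r -> nrm (T x) < 1.
  move=> xr; have := he x; rewrite -ball_normE /= !sub0r !normrN er !normE ltcR.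
  by move=> /(_ xr); rewrite ltcR.
(* Continuity at 0 sends the ball of radius r into the unit ball, and every nonzero x is rescaled to
   norm r / 2 to fit in it, whence 2 / r. *)
exists (2 / r) => [|x]; first by rewrite divr_ge0 // ltW.
have [x0|x0] := eqVneq (nrm x) 0.
  by rewrite (nrm_eq0 x0) T0 nrm0 mulr0.
have {x0} xp : 0 < nrm x by rewrite lt_def x0 nrm_ge0.
have := hr ((r / 2 / nrm x)%:C%C *: x).
rewrite bop_scale !nrmZr ger0_norm; last by rewrite !divr_ge0 // ltW.
rewrite divfK ?gt_eqF // => /(_ _)/ltW h.
have {}h : r / 2 / nrm x * nrm (T x) <= 1 by apply: h; lra.
have -> : nrm (T x) = (r / 2 / nrm x * nrm (T x)) * (2 / r * nrm x).
  by field; rewrite !gt_eqF.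
by rewrite -[leRHS]mul1r ler_wpM2r // mulr_ge0 ?nrm_ge0 // divr_ge0 // ltW.
Qed.

Lemma bop_of_bounded (f : H -> H) (M : R) :
  linear f -> (forall x, nrm (f x) <= M * nrm x) -> exists T, T =1 f.
Proof.
move=> lf bf.
have fB x y : f (x - y) = f x - f y.
  by rewrite addrC -scaleN1r lf scaleN1r addrC.
suff cf : continuous f by exists (Bop lf cf).
move=> x; apply/cvgrPdist_lt => e.
rewrite ltcE; case: e => e v /= /andP[/eqP -> {v} e0].
have M0 : 0 < `|M| + 1 by rewrite ltr_wpDl.
near=> y; rewrite -fB normE ltcR.
apply: le_lt_trans (bf _) _.
apply: (@le_lt_trans _ _ ((`|M| + 1) * nrm (x - y))).
  by rewrite ler_wpM2r ?nrm_ge0 // (le_trans (ler_norm M)) // lerDl.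
rewrite mulrC -ltr_pdivlMr // -ltcR -normE.
near: y; apply: (cvgr_dist_lt (fun y : H => y) x); first exact: cvg_id.
by rewrite ltcR divr_gt0.
Unshelve. all: by end_near. Qed.

(* The representing vector minimises |k|^2 - 2t over the graph of the functional. *)
Lemma riesz_on_subspace (G : H -> R -> Prop) (M : R) :
  G 0 0 ->
  (forall r k t k' t', G k t -> G k' t' -> G (r%:C%C *: k + k') (r * t + t')) ->
  (forall k t, G k t -> t <= M * nrm k) ->
  exists z, (forall k t, G k t -> rip k z = t) /\
    (forall e : R, 0 < e -> exists k t, G k t /\ nrm (k - z) < e).
Proof.
move=> G0 Glin Gbd.
pose J := [set s : R | exists k t, G k t /\ s = rip k k - 2 * t].
have Jlb : has_lbound J.
  exists (- M ^+ 2) => _ [k [t [Gkt ->]]].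
  have := Gbd _ _ Gkt; rewrite -nrm_sqr; have := nrm_ge0 k.
  by have := sqr_ge0 (nrm k - M); nra.
have J0 : J !=set0 by exists 0, 0, 0; rewrite rip0l mulr0 subr0.
have Jinf : has_inf J by [].
have infJ k t : G k t -> inf J <= rip k k - 2 * t.
  by move=> Gkt; apply: ge_inf => //; exists k, t.
have /choice[u hu] n : exists p : H * R, G p.1 p.2 /\
    rip p.1 p.1 - 2 * p.2 < inf J + n.+1%:R^-1.
  have [//|_ [k [t [Gkt ->]] h]] := @inf_adherent _ J n.+1%:R^-1 _ Jinf.
  by exists (k, t).
have small (e : R) : 0 < e -> exists N, forall n, (N <= n)%N -> n.+1%:R^-1 < e.
  move=> e0; exists (Num.truncn e^-1) => n hn.
  rewrite invf_plt ?posrE ?ltr0n //.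
  apply: lt_le_trans (_ : (Num.truncn e^-1).+1%:R <= _).
    by rewrite truncnS_gt.
  by rewrite ler_nat.
have [|z hz] := @complete_seq _ _ (fun n => (u n).1).
  move=> e e0; have [|N hN] := small (e ^+ 2 / 4).
    by rewrite divr_gt0 ?exprn_gt0.
  exists N => n m /hN hn /hN hm.
  have [Gn Jn] := hu n; have [Gm Jm] := hu m.
  (* The midpoint of [u n] and [u m] also lies in the graph, so its value is at least [inf J]; the
     parallelogram identity then bounds |u n - u m|^2 by 2 (1/(n+1) + 1/(m+1)). *)
  have G1 := Glin 1 _ _ _ _ Gn Gm.
  have := infJ _ _ (Glin (2^-1) _ _ _ _ G1 G0).
  rewrite addr0 !ripE (ripC (u m).1 (u n).1) => hi.
  have : nrm ((u n).1 - (u m).1) ^+ 2 < e ^+ 2.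
    rewrite nrm_sqr !ripE (ripC (u m).1 (u n).1).
    move: hn hm Jn Jm hi; move: (n.+1%:R^-1) (m.+1%:R^-1) (e ^+ 2) => p q s.
    by clear; lra.
  by rewrite ltr_pXn2r // ?nnegrE ?nrm_ge0 // ltW.
exists z; split; last first.
  move=> e e0; have [N hN] := hz e e0; exists (u N).1, (u N).2.
  by split; [case: (hu N) | exact: hN].
move=> k t Gkt.
pose D := rip k z - t.
(* First variation at the minimiser z: moving by r k cannot lower the functional. This is shown at
   [u n], up to 1/(n+1), and passed to the limit. *)
have pos r : 0 <= 2 * r * D + r ^+ 2 * rip k k.
  apply: (@le_of_eps _ _ (2 + 2 * `|r| * nrm k)) => e e0.
  have [N1 hN1] := small e e0; have [N2 hN2] := hz e e0.
  pose n := maxn N1 N2.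
  have := hN1 n (leq_maxl _ _); have := hN2 n (leq_maxr _ _) => h2 h1.
  have [Gn Jn] := hu n.
  have := infJ _ _ (Glin r _ _ _ _ Gkt Gn); rewrite !ripE (ripC (u n).1 k) => hi.
  have h3 : rip k ((u n).1 - z) * r <= e * (`|r| * nrm k).
    apply: le_trans (ler_norm _) _; rewrite normrM.
    apply: le_trans (_ : nrm k * nrm ((u n).1 - z) * `|r| <= _).
      by rewrite ler_wpM2r // rip_norm_le.
    have := ler_wpM2l (mulr_ge0 (normr_ge0 r) (nrm_ge0 k)) (ltW h2).
    nra.
  move: h3 hi h1 Jn; rewrite ripDr ripNr /D.
  move: (n.+1%:R^-1) (inf J) `|r| => p q s.
  move: (rip k z) (rip k k) (nrm k) (rip k _) (rip _ _) (_.2) => ? ? ? ? ? ?.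
  by move: e0; clear; lra.
have A0 := rip_ge0 k.
have A1 : 0 < rip k k + 1 by lra.
(* Adding 1 to |k|^2 covers k = 0; at this r the quadratic is a negative multiple of D^2, so D =
   0. *)
have := pos (- D / (rip k k + 1)).
have -> : 2 * (- D / (rip k k + 1)) * D + (- D / (rip k k + 1)) ^+ 2 * rip k k =
  - (D ^+ 2 * (rip k k + 2)) / (rip k k + 1) ^+ 2.
  by field; rewrite gt_eqF.
rewrite pmulr_lge0 ?invr_gt0 ?exprn_gt0 // oppr_ge0 pmulr_lle0; last by lra.
by move=> h; apply/subr0_eq/eqP; rewrite -sqrf_eq0 eq_le h sqr_ge0.
Qed.

(* The adjoint of a bounded, possibly partially defined operator given by its
   graph [D], extended by zero on the orthogonal complement of the domain. *)
Lemma adjoint_of_graph (D : H -> H -> Prop) (M : R) :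
  0 <= M -> D 0 0 ->
  (forall a k t k' t', D k t -> D k' t' -> D (a *: k + k') (a *: t + t')) ->
  (forall k t, D k t -> nrm t <= M * nrm k) ->
  exists U : bop H, [/\ forall k t y, D k t -> rip k (U y) = rip t y,
    forall X, (forall k t, D k t -> X k = 0) -> X * U = 0,
    forall y, nrm (U y) <= M * nrm y &
    forall S S', (forall x y, rip (S x) y = rip x (S' y)) ->
      (forall k t, D k t -> D (S k) (S t)) ->
      (forall k t, D k t -> D (S' k) (S' t)) -> U * S = S * U].
Proof.
move=> M0 D0 Dlin Dbd.
(* [app z] says that z lies in the closure of the domain of [D]; together with the pairings with the
   domain this determines z, which gives linearity of [U] and its commutation with [S]. *)
pose app z := forall e : R, 0 < e -> exists k t, D k t /\ nrm (k - z) < e.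
have /choice[U hU] y : exists z, (forall k t, D k t -> rip k z = rip t y) /\ app z.
  have [|r k s k' s' [t [Dt ->]] [t' [Dt' ->]]|k s [t [Dt ->]]|z [h1 h2]] :=
      @riesz_on_subspace (fun k s => exists t, D k t /\ s = rip t y) (M * nrm y).
  - by exists 0; rewrite rip0l.
  - by exists (r%:C%C *: t + t'); split; [exact: Dlin | rewrite !ripE].
  - apply: le_trans (rip_le _ _) _; rewrite mulrAC ler_wpM2r ?nrm_ge0 //.
    exact: Dbd.
  exists z; split=> [k t Dkt|e e0]; first by apply: h1; exists t.
  by have [k [s [[t [Dt _]] h]]] := h2 e e0; exists k, t.
have app_lin a z z' : app z -> app z' -> app (a *: z + z').
  move=> az az' e e0; pose na := complex.Re `|a|.
  have na0 : 0 <= na.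
    have := normr_ge0 a; rewrite /na; case: (`|a|) => u v.
    by rewrite lecE /= => /andP[].
  have [|k [t [Dk hk]]] := az (e / 2 / (na + 1)).
    by rewrite !divr_gt0 // ltr_wpDl.
  have [|k' [t' [Dk' hk']]] := az' (e / 2); first by rewrite divr_gt0.
  exists (a *: k + k'), (a *: t + t'); split; first exact: Dlin.
  rewrite opprD addrACA -scalerBr; apply: le_lt_trans (nrmD _ _) _.
  rewrite nrmZ -/na.
  have h : na * nrm (k - z) <= e / 2.
    apply: le_trans (ler_wpM2l na0 (ltW hk)) _.
    rewrite mulrA ler_pdivrMr; last by lra.
    have : 0 < e / 2 by rewrite divr_gt0.
    nra.
  lra.
have orth z d : app z -> (forall k t, D k t -> rip k d = 0) -> rip z d = 0.
  move=> az hd; apply/eqP; rewrite -normr_le0.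
  apply: (@le_of_eps _ _ (nrm d)) => e e0; have [k [t [Dk hk]]] := az e e0.
  rewrite add0r -normrN -[- _]add0r -(hd _ _ Dk) -ripNl -ripDl.
  apply: le_trans (rip_norm_le _ _) _; rewrite ler_wpM2r ?nrm_ge0 //.
  exact: ltW.
have uniq z z' : app z -> app z' ->
    (forall k t, D k t -> rip k z = rip k z') -> z = z'.
  move=> az az' h; apply/subr0_eq/rip_eq0.
  suff -> : rip (z - z') (z - z') = 0 by [].
  apply: orth => [|k t Dk]; last by rewrite ripDr ripNr (h _ _ Dk) subrr.
  by rewrite addrC -scaleN1r; exact: app_lin.
have Ulin : linear U.
  move=> a y y'; have [h1 a1] := hU (a *: y + y').
  have [h2 a2] := hU y; have [h3 a3] := hU y'.
  apply: uniq => // [|k t Dk]; first exact: app_lin.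
  rewrite (h1 _ _ Dk) !ripDr (h3 _ _ Dk) -(conjcK a) -!ripZ_conj; congr (_ + _).
  have Dk' : D (a^*%C *: k) (a^*%C *: t).
    by have := Dlin a^*%C _ _ _ _ Dk D0; rewrite !addr0.
  by rewrite (h2 _ _ Dk').
have Ubd y : nrm (U y) <= M * nrm y.
  have [h ay] := hU y.
  have hq : nrm (U y) ^+ 2 <= M * nrm y * nrm (U y).
    apply: (@le_of_eps _ _ (nrm (U y) + M * nrm y)) => e e0.
    have [k [t [Dk hk]]] := ay e e0.
    rewrite nrm_sqr -{1}(subrK k (U y)) ripDl (h _ _ Dk).
    have h1 := rip_le (U y - k) (U y); rewrite nrmB in h1.
    have h2 := rip_le t y; have h3 := Dbd _ _ Dk.
    have h4 := nrmD (k - U y) (U y); rewrite subrK in h4.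
    have h5 := nrm_ge0 (U y); have h6 := nrm_ge0 y.
    have h7 := ler_wpM2r h5 (ltW hk).
    have h8 := ler_wpM2r h6 h3.
    have h9 : nrm k <= e + nrm (U y) by lra.
    have h10 := ler_wpM2l (mulr_ge0 M0 h6) h9.
    nra.
  have [u0|u0] := eqVneq (nrm (U y)) 0.
    by rewrite u0 mulr_ge0 ?nrm_ge0.
  have up : 0 < nrm (U y) by rewrite lt_def u0 nrm_ge0.
  by rewrite -(ler_pM2r up) -expr2.
have [V VU] := bop_of_bounded Ulin Ubd.
exists V; split=> [k t y Dk|X XD|y|S S' SS' DS DS'].
- by rewrite VU; have [h _] := hU y; exact: h.
- apply: bopP => y /=; rewrite VU.
  have [_ ay] := hU y; have [B B0 hB] := bop_bounded X.
  apply: nrm_eq0; apply/eqP; rewrite eq_le nrm_ge0 andbT.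
  apply: (@le_of_eps _ _ B) => e e0; have [k [t [Dk hk]]] := ay e e0.
  have -> : X (U y) = X (U y - k).
    by rewrite bopB (XD _ _ Dk) subr0.
  rewrite add0r mulrC; apply: le_trans (hB _) _.
  by rewrite ler_wpM2l // nrmB ltW.
- by rewrite VU.
- apply: bopP => y /=; rewrite !VU.
  have [h1 a1] := hU y; have [h2 a2] := hU (S y).
  apply: uniq => // [e e0|k t Dk].
    have [B B0 hB] := bop_bounded S.
    have [|k [t [Dk hk]]] := a1 (e / (B + 1)).
      by rewrite divr_gt0 // ltr_wpDl.
    exists (S k), (S t); split; first exact: DS.
    have -> : S k - S (U y) = S (k - U y).
      by rewrite bopB.
    apply: le_lt_trans (hB _) _.
    apply: le_lt_trans (_ : (B + 1) * nrm (k - U y) < e).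
      by rewrite ler_wpM2r ?nrm_ge0 // lerDl.
    by rewrite mulrC -ltr_pdivlMr // ltr_wpDl.
  rewrite (h2 _ _ Dk) (ripC t) SS' (ripC y) -(h1 _ _ (DS' _ _ Dk)).
  by rewrite (ripC k) SS' ripC.
Qed.

End BoundedOperatorTheory.

(** * Adjoint calculus, uniform bounds, completeness and inverses *)

Section Adjoint.
Context (R : realType) (H : hilbertType R).
Implicit Types (x y z : H) (a : R[i]) (r : R) (S T X : bop H).

(** The relation t = T k has full domain, so its adjoint has the property required in [adjoint], and
    the default value of [xget] never arises. The complex identity follows from two instances of the
    real one. *)
Lemma adjointP T x y : rip (T x) y = rip x (adjoint T y).
Proof.
suff h : forall x y, inner (T x) y = inner x (adjoint T y) by rewrite /rip h.
have [M M0 hM] := bop_bounded T.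
have [||k s|U [hU _ _ _]] :=
    @adjoint_of_graph _ _ (fun k t => t = T k) M M0.
- by rewrite bop0.
- by move=> b k t k' t' -> ->; rewrite bop_linear.
- by move=> ->; exact: hM.
have := @xgetPex _ (0 : bop H)
  [set S : bop H | forall x y, inner (T x) y = inner x (S y)]; apply.
exists U => u v; rewrite !rip_inner -bop_scale.
by rewrite (hU _ _ _ erefl) (hU _ _ _ erefl).
Qed.

Lemma adjoint_uniq S T : (forall x y, rip (T x) y = rip x (S y)) -> adjoint T = S.
Proof.
by move=> h; apply: bopP => y; apply: rip_inj => z; rewrite -h adjointP.
Qed.

Lemma adjointK : involutive (@adjoint R H).
Proof. by move=> T; apply: adjoint_uniq => x y; rewrite ripC -adjointP ripC. Qed.

Lemma adjointD S T : adjoint (S + T) = adjoint S + adjoint T.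
Proof. by apply: adjoint_uniq => x y /=; rewrite ripDl ripDr !adjointP. Qed.

Lemma adjointN T : adjoint (- T) = - adjoint T.
Proof. by apply: adjoint_uniq => x y /=; rewrite ripNl ripNr adjointP. Qed.

Lemma adjointB S T : adjoint (S - T) = adjoint S - adjoint T.
Proof. by rewrite adjointD adjointN. Qed.

Lemma adjointM S T : adjoint (S * T) = adjoint T * adjoint S.
Proof. by apply: adjoint_uniq => x y /=; rewrite !adjointP. Qed.

Lemma adjoint1 : adjoint (1 : bop H) = 1.
Proof. exact: adjoint_uniq. Qed.

Lemma adjoint0 : adjoint (0 : bop H) = 0.
Proof. by apply: adjoint_uniq => x y /=; rewrite rip0l rip0r. Qed.

Lemma adjointZ a T : adjoint (a *: T) = a^*%C *: adjoint T.
Proof. by apply: adjoint_uniq => x y /=; rewrite ripZ_conj adjointP bop_scale. Qed.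

Lemma bop_eqr S T : (forall x y, rip (S x) y = rip (T x) y) -> S = T.
Proof.
by move=> h; apply: bopP => x; apply: rip_inj => z; rewrite ripC h ripC.
Qed.

Lemma scale_bopAl a S T : a *: (S * T) = (a *: S) * T.
Proof. exact: bopP. Qed.

Lemma scale_bopAr a S T : a *: (S * T) = S * (a *: T).
Proof. by apply: bopP => x /=; rewrite bop_scale. Qed.

Lemma adjoint_mul_eq0 T : adjoint T * T = 0 -> T = 0.
Proof.
move=> h; apply: bopP => x; apply: rip_eq0; rewrite adjointP.
by move: (congr1 (fun S : bop H => S x) h) => /= ->; rewrite rip0r.
Qed.

Definition bnd r T := forall x, nrm (T x) <= r * nrm x.

Lemma bnd_exists T : exists2 r, 0 <= r & bnd r T.
Proof. exact: bop_bounded. Qed.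

Lemma bndW r s T : r <= s -> bnd r T -> bnd s T.
Proof.
by move=> rs h x; apply: le_trans (h x) _; rewrite ler_wpM2r ?nrm_ge0.
Qed.

Lemma bndD r s S T : bnd r S -> bnd s T -> bnd (r + s) (S + T).
Proof. by move=> hS hT x; apply: le_trans (nrmD _ _) _; rewrite mulrDl lerD. Qed.

Lemma bndN r T : bnd r T -> bnd r (- T).
Proof. by move=> h x; rewrite nrmN. Qed.

Lemma bndB r s S T : bnd r S -> bnd s T -> bnd (r + s) (S - T).
Proof. by move=> hS /bndN; exact: bndD. Qed.

Lemma bndM r s S T : 0 <= r -> bnd r S -> bnd s T -> bnd (r * s) (S * T).
Proof.
move=> r0 hS hT x; apply: le_trans (hS _) _.
by rewrite -mulrA ler_wpM2l.
Qed.

Lemma bndZ r s T : bnd s T -> bnd (`|r| * s) (r%:C%C *: T).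
Proof. by move=> h x /=; rewrite nrmZr -mulrA ler_wpM2l. Qed.

Lemma bnd1 : bnd 1 1.
Proof. by move=> x; rewrite mul1r. Qed.

Lemma bnd0 : bnd 0 0.
Proof. by move=> x; rewrite nrm0 mul0r. Qed.

Lemma bnd_adjoint r T : 0 <= r -> bnd r T -> bnd r (adjoint T).
Proof.
move=> r0 h y; have [u0|u0] := eqVneq (nrm (adjoint T y)) 0.
  by rewrite u0 mulr_ge0 ?nrm_ge0.
have up : 0 < nrm (adjoint T y) by rewrite lt_def u0 nrm_ge0.
rewrite -(ler_pM2r up) -expr2 nrm_sqr -adjointP.
by apply: le_trans (rip_le _ _) _; rewrite mulrAC ler_wpM2r ?nrm_ge0.
Qed.

Lemma bnd_isometry T : adjoint T * T = 1 -> bnd 1 T.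
Proof.
move=> h x; rewrite mul1r ler_nrm adjointP.
by move: (congr1 (fun S : bop H => S x) h) => /= ->.
Qed.

Lemma bnd_eq0 r T : (forall e, 0 < e -> bnd (e * r) T) -> T = 0.
Proof.
move=> h; apply: bopP => x; apply: nrm_eq0; apply/eqP.
rewrite eq_le nrm_ge0 andbT; apply: (@le_of_eps _ _ _ (r * nrm x)) => e e0.
by rewrite add0r mulrA; exact: h.
Qed.

Lemma bnd_lim r s T : (forall e, 0 < e -> bnd (r + e * s) T) -> bnd r T.
Proof.
move=> h x; apply: (@le_of_eps _ _ _ (s * nrm x)) => e e0.
by rewrite mulrA -mulrDl; exact: h.
Qed.

(** Pointwise limits exist by completeness of [H]; letting one index tend to infinity makes the
    convergence uniform on bounded sets, and linearity and boundedness follow. *)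
Lemma bop_complete (Y : nat -> bop H) :
  (forall e, 0 < e -> exists N, forall n m, (N <= n)%N -> (N <= m)%N ->
    bnd e (Y n - Y m)) ->
  exists Z, forall e, 0 < e -> exists N, forall n, (N <= n)%N -> bnd e (Y n - Z).
Proof.
move=> YC.
have /choice[f hf] x : exists l, forall e : R, 0 < e -> exists N, forall n,
    (N <= n)%N -> nrm (Y n x - l) < e.
  apply: complete_seq => e e0.
  have x0 : 0 < nrm x + 1 by rewrite ltr_wpDl ?nrm_ge0.
  have [|N hN] := YC (e / (nrm x + 1)); first exact: divr_gt0.
  exists N => n m hn hm; apply: le_lt_trans (hN _ _ hn hm x) _.
  by rewrite mulrAC ltr_pdivrMr // ltr_pM2l // ltrDl.
have hu e : 0 < e -> exists N, forall n, (N <= n)%N -> forall x,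
    nrm (Y n x - f x) <= e * nrm x.
  move=> e0; have [N hN] := YC e e0; exists N => n hn x.
  apply: (@le_of_eps _ _ _ 1) => d d0; have [N' hN'] := hf x d d0.
  apply: le_trans (nrm_triangle (Y (maxn N N') x) _ _) _.
  rewrite mulr1; apply: lerD; first exact: (hN _ _ hn (leq_maxl _ _)).
  exact/ltW/hN'/leq_maxr.
have flin : linear f.
  move=> a x y; apply/subr0_eq/nrm_eq0/eqP; rewrite eq_le nrm_ge0 andbT.
  apply: (@le_of_eps _ _ _
    (nrm (a *: x + y) + complex.Re `|a| * nrm x + nrm y)) => e e0.
  have [N hN] := hu e e0; have {}hN := hN N (leqnn N); rewrite add0r.
  have -> : f (a *: x + y) - (a *: f x + f y) =
      - (Y N (a *: x + y) - f (a *: x + y)) + a *: (Y N x - f x) +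
      (Y N y - f y).
    rewrite bop_linear scalerBr opprB -[RHS]addrA [X in _ = _ + X]addrACA.
    by rewrite -opprD addrA subrK.
  rewrite !mulrDr; apply: le_trans (nrmD _ _) _; apply: lerD => //.
  apply: le_trans (nrmD _ _) _; apply: lerD; first by rewrite nrmN.
  rewrite nrmZ mulrCA ler_wpM2l //.
  by have := normr_ge0 a; case: (`|a|) => u v; rewrite lecE /= => /andP[].
have [N0 hN0] := hu 1 ltr01; have {}hN0 := hN0 N0 (leqnn _).
have [M M0 hM] := bnd_exists (Y N0).
have [|Z ZE] := bop_of_bounded flin (M := M + 1).
  move=> x; rewrite -(subrK (Y N0 x) (f x)) mulrDl addrC.
  by apply: le_trans (nrmD _ _) _; apply: lerD (hM x) _; rewrite nrmB.
exists Z => e /hu[N hN]; exists N => n /hN h x.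
by rewrite /= ZE; exact: h.
Qed.

(** [U] is the adjoint of the relation sending T t to t, which yields T U = 1. Taking adjoints gives
    [adjoint U * T = 1], hence [adjoint U = U], and [U] is also a left inverse. *)
Lemma selfadjoint_inverse T r : 0 <= r -> adjoint T = T ->
  (forall x, nrm x <= r * nrm (T x)) ->
  exists U, [/\ T * U = 1, U * T = 1, adjoint U = U & bnd r U].
Proof.
move=> r0 sT hT.
have [||k s|U [hU _ bU _]] :=
    @adjoint_of_graph _ _ (fun k t => k = T t) r r0.
- by rewrite bop0.
- by move=> a k t k' t' -> ->; rewrite bop_linear.
- by move=> ->; exact: hT.
have TU : T * U = 1.
  apply: bopP => y; apply: rip_inj => z; rewrite /= -{1}sT -adjointP.
  by rewrite (hU _ _ _ erefl).
have UT : adjoint U * T = 1 by rewrite -{1}sT -adjointM TU adjoint1.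
have sU : adjoint U = U by rewrite -[LHS]mulr1 -TU mulrA UT mul1r.
by exists U; split=> //; rewrite -sU.
Qed.

Lemma commute_inverse S T U : T * U = 1 -> U * T = 1 ->
  S * T = T * S -> S * U = U * S.
Proof.
move=> TU UT ST.
by rewrite -[LHS]mul1r -UT -mulrA (mulrA T) -ST -(mulrA S) TU mulr1.
Qed.

End Adjoint.

(* Testing against vectors turns an identity of operators into one of the
   commutative ring R. *)
Ltac bop_ring :=
  apply: bop_eqr => ? ? /=; rewrite ?(bop_raddf, bopN, bop_scale) /= !ripE; ring.

(** * Square root of 1 - B *)

Section SquareRoot.
Context (R : realType) (H : hilbertType R).
Implicit Types (x y z : H) (r : R) (S T X B : bop H).

Let half : R[i] := (2^-1 : R)%:C%C.

Let half2 (V : lmodType R[i]) (v : V) : half *: (v + v) = v.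
Proof.
rewrite -{1 2}(scale1r v) -scalerDl scalerA /half -(rmorph1 (real_complex R)).
by rewrite -rmorphD -rmorphM /= (_ : 2^-1 * (1 + 1) = 1 :> R) ?scale1r //; field.
Qed.

(* With y = 1 - sqrt (1 - B) one has y = (B + y^2) / 2; the iterates converge
   because they are dominated by those of t |-> (1 + t^2) / 2 on [0, 1]. *)
Lemma sqrt_one_sub B : adjoint B = B -> bnd 1 B ->
  exists Z, [/\ adjoint Z = Z, bnd 1 Z, (1 - Z) * (1 - Z) = 1 - B &
    forall S, S * B = B * S -> S * Z = Z * S].
Proof.
move=> sB bB.
pose F X := half *: (B + X * X); pose Y n := iter n F 0.
pose f (s : R) : R := (1 + s ^+ 2) / 2; pose t n := iter n f 0.
have t01 n : 0 <= t n <= 1.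
  elim: n => [|n] /=; first by rewrite lexx ler01.
  by rewrite -/(t n) /f => /andP[h1 h2]; apply/andP; split; nra.
have tS n : t n <= t n.+1.
  rewrite /= -/(t n) /f; have := t01 n => /andP[h1 h2].
  by have := sqr_ge0 (1 - t n); nra.
have bnd_half r S : bnd r S -> bnd (r / 2) (half *: S).
  move=> h; have := bndZ (2^-1) h; rewrite ger0_norm ?invr_ge0 //.
  by rewrite mulrC.
(* Each iterate and each increment is dominated by its scalar counterpart; the increment of the
   square splits as Y' (Y' - Y) + (Y' - Y) Y. *)
have bY n : bnd (t n) (Y n) /\ bnd (t n.+1 - t n) (Y n.+1 - Y n).
  have bF n' : bnd (t n') (Y n') -> bnd (t n'.+1) (Y n'.+1).
    move=> h; apply: bnd_half; apply: bndD => //; rewrite expr2.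
    by apply: bndM => //; case/andP: (t01 n').
  elim: n => [|n [h1 h2]].
    split; first exact: bnd0.
    by rewrite !subr0; apply: bF; exact: bnd0.
  split; first exact: bF.
  have -> : Y n.+2 - Y n.+1 =
      half *: (Y n.+1 * (Y n.+1 - Y n) + (Y n.+1 - Y n) * Y n).
    rewrite -scalerBr; congr (_ *: _).
    by rewrite mulrBr mulrBl addrA subrK opprD addrACA subrr add0r.
  have -> : t n.+2 - t n.+1 =
      (t n.+1 * (t n.+1 - t n) + (t n.+1 - t n) * t n) / 2.
    rewrite -[t n.+2]/(f (t n.+1)) -[X in _ - X = _]/(f (t n)) /f.
    by ring.
  have /andP[p1 _] := t01 n.+1.
  apply: bnd_half; apply: bndD; apply: bndM => //; first exact: bF.
  by rewrite subr_ge0.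
have tmono n k : t n <= t (n + k)%N.
  elim: k => [|k IH]; first by rewrite addn0.
  by rewrite addnS; apply: le_trans IH (tS _).
have bYk n k : bnd (t (n + k)%N - t n) (Y (n + k)%N - Y n).
  elim: k => [|k IH]; first by rewrite addn0 !subrr; exact: bnd0.
  rewrite addnS; have [_ h] := bY (n + k)%N.
  have := bndD h IH.
  by rewrite !addrA !subrK.
(* The scalars [t n] increase and stay below 1, so closeness to their supremum controls all later
   increments, and [Y] is Cauchy. *)
pose E := [set s | exists n, s = t n].
have sE : has_sup E.
  split; first by exists (t 0%N), 0%N.
  by exists 1 => _ [n ->]; case/andP: (t01 n).
have tsup n : t n <= sup E by apply: ub_le_sup; [case: sE | exists n].
have [e e0|Z hZ] := @bop_complete _ _ Y.
  have [_ [N ->] hN] := sup_adherent e0 sE.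
  exists N.
  have aux n k : (N <= n)%N -> bnd e (Y (n + k)%N - Y n).
    move=> hn; apply: bndW (bYk n k).
    have h1 := tsup (n + k)%N; have h2 := tmono N (n - N)%N.
    by rewrite subnKC // in h2; lra.
  move=> n m hn hm; case: (leqP n m) => [nm|/ltnW mn].
    by rewrite -opprB; apply: bndN; rewrite -(subnKC nm); exact: aux.
  by rewrite -(subnKC mn); exact: aux.
have sY n : adjoint (Y n) = Y n.
  elim: n => [|n IH]; first exact: adjoint0.
  by rewrite /= -/(Y n) /F adjointZ conjc_real adjointD adjointM sB IH.
have bY1 n : bnd 1 (Y n).
  by case: (bY n) => h _; apply: bndW h; case/andP: (t01 n).
have bZ : bnd 1 Z.
  apply: (@bnd_lim _ _ _ 1) => e e0; have [N hN] := hZ e e0.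
  rewrite mulr1 -[Z]opprK -(addrK (Y N) (- Z)) opprB.
  by apply: bndB => //; rewrite addrC; exact: hN.
have ZF : Z = half *: (B + Z * Z).
  apply: subr0_eq; apply: (@bnd_eq0 _ _ 2) => e e0; have [N hN] := hZ e e0.
  have -> : Z - half *: (B + Z * Z) =
     - (Y N.+1 - Z) + half *: (Y N * (Y N - Z) + (Y N - Z) * Z).
    by rewrite /= -/(Y N) /F /half; bop_ring.
  have -> : e * 2 = e + (1 * e + e * 1) / 2 by field.
  apply: bndD; first exact/bndN/hN.
  apply: bnd_half; apply: bndD; apply: bndM => //; try exact: hN.
  exact: ltW.
exists Z; split=> //.
- apply: subr0_eq; apply: (@bnd_eq0 _ _ 2) => e e0; have [N hN] := hZ e e0.
  rewrite mulr_natr mulr2n.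
  have -> : adjoint Z - Z = (Y N - Z) - adjoint (Y N - Z).
    by rewrite adjointB sY; bop_ring.
  by apply: bndB; last apply: bnd_adjoint (ltW e0) _; exact: hN.
- have Z2 : Z + Z = B + Z * Z.
    by rewrite {1 2}ZF -scalerDr half2.
  have -> : (1 - Z) * (1 - Z) = 1 - (Z + Z) + Z * Z by bop_ring.
  by rewrite Z2; bop_ring.
- move=> S SB; apply: subr0_eq.
  have [s s0 bS] := bnd_exists S.
  apply: (@bnd_eq0 _ _ (s + s)) => e e0; have [N hN] := hZ e e0.
  have SY : S * Y N = Y N * S.
    elim: N {hN} => [|n IH]; first by rewrite mulr0 mul0r.
    rewrite /= -/(Y n) /F -scale_bopAr -scale_bopAl mulrDr mulrDl SB.
    by rewrite mulrA IH -mulrA IH mulrA.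
  have -> : S * Z - Z * S = (Y N - Z) * S - S * (Y N - Z).
    by rewrite mulrBl mulrBr SY; bop_ring.
  rewrite mulrDr; apply: bndB; first by apply: bndM (ltW e0) _ bS; exact: hN.
  by rewrite mulrC; apply: bndM => //; exact: hN.
Qed.

End SquareRoot.

(** * Operators constructed inside a von Neumann algebra *)

Section VonNeumann.
Context (R : realType) (H : hilbertType R) (A : set (bop H)).
Context (hA : von_neumann_algebra A).
Implicit Types (r : R) (S T X : bop H).

Lemma vN0 : A 0.
Proof.
have := vN_linear hA (-1) (vN1 hA) (vN1 hA).
by rewrite scaleN1r addNr.
Qed.

Lemma vN_scale a T : A T -> A (a *: T).
Proof. by move=> hT; have := vN_linear hA a hT vN0; rewrite addr0. Qed.

Lemma vN_add S T : A S -> A T -> A (S + T).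
Proof. by move=> hS hT; have := vN_linear hA 1 hS hT; rewrite scale1r. Qed.

Lemma vN_opp T : A T -> A (- T).
Proof. by move=> /(vN_scale (-1)); rewrite scaleN1r. Qed.

Lemma vN_sub S T : A S -> A T -> A (S - T).
Proof. by move=> hS /vN_opp; exact: vN_add. Qed.

(** Bicommutant property: inverses, square roots and adjoints of relations are placed in [A] by
    showing that they commute with its commutant. *)
Lemma vN_of_commute T : (forall S, commutant A S -> T * S = S * T) -> A T.
Proof. by move=> h; rewrite -(vN_bicommutant hA). Qed.

Lemma commutant_adjoint S : commutant A S -> commutant A (adjoint S).
Proof.
move=> hS T hT.
by rewrite -(adjointK T) -!adjointM hS //; exact: vN_adjoint.
Qed.

Lemma vN_inverse T U : A T -> T * U = 1 -> U * T = 1 -> A U.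
Proof.
move=> hT TU UT; apply: vN_of_commute => S hS.
by symmetry; apply: commute_inverse TU UT _; exact: hS.
Qed.

Lemma vN_sqrt_one_sub B : A B -> adjoint B = B -> bnd 1 B ->
  exists y, [/\ A y, adjoint y = y, bnd 1 y & (1 - y) * (1 - y) = 1 - B].
Proof.
move=> hB sB bB; have [y [sy by1 ey cy]] := sqrt_one_sub sB bB.
exists y; split=> //; apply: vN_of_commute => S hS.
by symmetry; apply: cy; exact: hS.
Qed.

Lemma bnd_one_sub_sqr T : bnd 1 T -> bnd 1 (1 - adjoint T * T).
Proof.
move=> bT x; rewrite mul1r ler_nrm /=.
have := bT x; rewrite mul1r ler_nrm => h1.
have := bnd_adjoint ler01 bT (T x); rewrite mul1r ler_nrm => h2.
rewrite !ripE -adjointP (ripC (adjoint T (T x)) x) -adjointP.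
have := rip_ge0 (T x); lra.
Qed.

(** The absolute value of T, obtained from B = 1 - T^* T. It is kept in the form 1 - y with |y| <= 1
    because this form also shows that it is positive. *)
Lemma vN_abs T : A T -> bnd 1 T ->
  exists y, [/\ A y, adjoint y = y, bnd 1 y &
    (1 - y) * (1 - y) = adjoint T * T].
Proof.
move=> hT bT.
have [||y [hy sy by1 ey]] := vN_sqrt_one_sub _ _ (bnd_one_sub_sqr bT).
- by apply: vN_sub (vN1 hA) _; apply: vN_mul => //; exact: vN_adjoint.
- by rewrite adjointB adjoint1 adjointM adjointK.
by exists y; split=> //; rewrite ey opprB addrC subrK.
Qed.

Lemma vN_adjoint_of_graph (D : H -> H -> Prop) (M : R) :
  0 <= M -> D 0 0 ->
  (forall a k t k' t', D k t -> D k' t' -> D (a *: k + k') (a *: t + t')) ->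
  (forall k t, D k t -> nrm t <= M * nrm k) ->
  (forall S, commutant A S -> forall k t, D k t -> D (S k) (S t)) ->
  exists U, [/\ A U, forall k t y, D k t -> rip k (U y) = rip t y,
    forall X, (forall k t, D k t -> X k = 0) -> X * U = 0 &
    forall y, nrm (U y) <= M * nrm y].
Proof.
move=> M0 D0 Dlin Dbd DA.
have [U [h1 h2 h3 h4]] := adjoint_of_graph M0 D0 Dlin Dbd.
exists U; split=> //; apply: vN_of_commute => S hS.
apply: (h4 S (adjoint S)); [exact: adjointP | exact: DA |].
exact/DA/commutant_adjoint.
Qed.

(* [pi] is the projection onto the closure of the range of [P], and [v] is the
   partial isometry with initial projection [pi] in the polar decomposition. *)
Lemma vN_polar P T : A P -> A T -> adjoint P = P -> adjoint T * T = P * P ->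
  exists pi v, [/\ A v, adjoint v * v = pi, v * pi = v, v * P = T &
    adjoint pi = pi /\ forall X, X * P = 0 -> X * pi = 0].
Proof.
move=> hP hT sP TP.
have PC S : commutant A S -> forall x, S (P x) = P (S x).
  by move=> hS x; have := congr1 (fun X : bop H => X x) (hS _ hP).
have TC S : commutant A S -> forall x, S (T x) = T (S x).
  by move=> hS x; have := congr1 (fun X : bop H => X x) (hS _ hT).
have [||||pi [_ pi1 pi2 _]] :=
    @vN_adjoint_of_graph (fun k t => exists x, k = P x /\ t = P x) 1 ler01.
- by exists 0; rewrite bop0.
- move=> a _ _ _ _ [x [-> ->]] [x' [-> ->]].
  by exists (a *: x + x'); rewrite bop_linear.
- by move=> _ _ [x [-> ->]]; rewrite mul1r.
- by move=> S hS _ _ [x [-> ->]]; exists (S x); rewrite PC.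
(* The relation P x -> T x is isometric because T^* T = P^2; the partial isometry v is the adjoint
   of [U]. *)
have [||||U [hU U1 U2 _]] :=
    @vN_adjoint_of_graph (fun k t => exists x, k = P x /\ t = T x) 1 ler01.
- by exists 0; rewrite !bop0.
- move=> a _ _ _ _ [x [-> ->]] [x' [-> ->]].
  by exists (a *: x + x'); rewrite !bop_linear.
- move=> _ _ [x [-> ->]]; rewrite mul1r ler_nrm adjointP.
  rewrite [leRHS]adjointP sP.
  by move: (congr1 (fun X : bop H => X x) TP) => /= ->.
- by move=> S hS _ _ [x [-> ->]]; exists (S x); rewrite PC // TC.
have dpi X : X * P = 0 -> X * pi = 0.
  move=> XP; apply: pi2 => _ _ [x [-> _]].
  exact: (congr1 (fun Y : bop H => Y x) XP).
have dU X : X * P = 0 -> X * U = 0.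
  move=> XP; apply: U2 => _ _ [x [-> _]].
  exact: (congr1 (fun Y : bop H => Y x) XP).
have Ppi : P * pi = P.
  apply: bop_eqr => x y /=; rewrite adjointP sP ripC (pi1 (P y) (P y)).
    by rewrite ripC adjointP sP.
  by exists y.
have PU : P * U = adjoint T.
  apply: bop_eqr => x y /=; rewrite adjointP sP ripC (U1 (P y) (T y)).
    by rewrite ripC adjointP adjointK.
  by exists y.
have piP : adjoint pi * P = P by rewrite -{1}sP -adjointM Ppi sP.
have pipi : adjoint pi * pi = pi.
  apply: subr0_eq; rewrite -[X in _ - X]mul1r -mulrBl; apply: dpi.
  by rewrite mulrBl piP mul1r subrr.
have spi : adjoint pi = pi by rewrite -pipi adjointM adjointK.
rewrite spi in piP pipi.
have piU : pi * U = U.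
  apply: subr0_eq; rewrite -[X in _ - X]mul1r -mulrBl; apply: dU.
  by rewrite mulrBl piP mul1r subrr.
have vP : adjoint U * P = T by rewrite -{1}sP -adjointM PU adjointK.
have vpi : adjoint U * pi = adjoint U by rewrite -{1}spi -adjointM piU.
exists pi, (adjoint U); split=> //; first exact: vN_adjoint.
rewrite adjointK.
(* To prove U U^* = pi, start from P (U U^* - 1) P = 0 and replace each outer factor P by pi: the
   right one directly, the left one after taking adjoints. *)
have h0 : P * (U * adjoint U - 1) * P = 0.
  by rewrite mulrBr mulr1 mulrBl mulrA PU -mulrA vP TP subrr.
have h1 : pi * (U * adjoint U - 1) * P = 0.
  rewrite -[RHS]adjoint0 -(dpi _ h0) !adjointM spi sP adjointB adjointM adjointK.
  by rewrite adjoint1 mulrA.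
have := dpi _ h1; rewrite -mulrA mulrBl mul1r -mulrA vpi mulrBr mulrA piU pipi.
by move=> /subr0_eq.
Qed.
End VonNeumann.

(** * Factors, partial isometries and unitary polar decomposition *)

Section FiniteFactor.
Context (R : realType) (H : hilbertType R) (A : set (bop H)).
Context (fA : von_neumann_factor A).
Implicit Types (r : R) (S T X w v e f : bop H).

Let hA : von_neumann_algebra A := fA.1.

(* The projection onto the vectors killed by all [f * T] is central. *)
Lemma factor_prime e f : A f -> (forall T, A T -> f * T * e = 0) ->
  e = 0 \/ f = 0.
Proof.
move=> hf h.
pose D k t := k = t /\ forall T, A T -> f (T k) = 0.
have [|||U [U1 U2 _ U4]] := @adjoint_of_graph _ _ D 1 ler01.
- by split=> // T hT; rewrite !bop0.
- move=> a k _ k' _ [<- hk] [<- hk']; split=> // T hT.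
  by rewrite !bop_linear hk // hk' // scaler0 addr0.
- by move=> k _ [<- _]; rewrite mul1r.
have DA S : A S -> forall k t, D k t -> D (S k) (S t).
  move=> hS k _ [<- hk]; split=> // T hT.
  by apply: (hk (T * S)); exact: vN_mul.
have DA' S : commutant A S -> forall k t, D k t -> D (S k) (S t).
  move=> hS k _ [<- hk]; split=> // T hT.
  have ST : T (S k) = S (T k) by have := congr1 (fun X : bop H => X k) (hS _ hT).
  have Sf : f (S (T k)) = S (f (T k)).
    by have := congr1 (fun X : bop H => X (T k)) (hS _ hf).
  by rewrite ST Sf hk // bop0.
have AU : A U.
  apply: (vN_of_commute hA) => S hS; apply: (U4 S (adjoint S)).
  - exact: adjointP.
  - exact: DA'.
  - exact/DA'/(commutant_adjoint hA).
have A'U : commutant A U.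
  move=> S hS; apply: (U4 S (adjoint S)); first exact: adjointP.
  - exact: DA.
  - exact/DA/(vN_adjoint hA).
have : (A `&` commutant A) U by [].
rewrite fA.2 => -[a _ aU].
(* The range of e lies in the subspace, so [U] fixes it, while f annihilates the range of [U]. As
   [U] is a scalar, one of e and f vanishes. *)
have eU : adjoint e * U = adjoint e.
  apply: bopP => y; apply: rip_inj => z /=; rewrite -!adjointP.
  apply: (U1 (e z) (e z)); split=> // T hT.
  exact: (congr1 (fun X : bop H => X z) (h _ hT)).
have fU : f * U = 0.
  by apply: U2 => k _ [_ hk]; exact: (hk 1 (vN1 hA)).
have [a0|a0] := eqVneq a 0.
  by left; rewrite -(adjointK e) -eU -aU a0 scale0r mulr0 adjoint0.
right; apply: (scalerI a0).
by rewrite scaler0 -fU -aU -scale_bopAr mulr1.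
Qed.

Definition pisom w := w * adjoint w * w = w.

Lemma pisom_bnd w : pisom w -> bnd 1 w.
Proof.
move=> hw x; rewrite mul1r.
have hx : rip (adjoint w (w x)) (adjoint w (w x)) = rip (w x) (w x).
  by rewrite -adjointP; move: (congr1 (fun X : bop H => X x) hw) => /= ->.
have : rip (w x) (w x) <= nrm x * nrm (w x).
  have -> : nrm (w x) = nrm (adjoint w (w x)).
    by apply/eqP; rewrite eq_le !ler_nrm hx lexx.
  by rewrite adjointP rip_le.
rewrite -nrm_sqr; have := nrm_ge0 (w x); have := nrm_ge0 x; nra.
Qed.

Lemma pisom_adjoint w : pisom w -> adjoint w * w * adjoint w = adjoint w.
Proof. by move=> hw; rewrite -[in RHS]hw !adjointM adjointK mulrA. Qed.

Lemma pisom_proj w : pisom w ->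
  adjoint w * w * (adjoint w * w) = adjoint w * w.
Proof. by move=> hw; rewrite mulrA pisom_adjoint. Qed.

Lemma adjoint_proj w : adjoint (adjoint w * w) = adjoint w * w.
Proof. by rewrite adjointM adjointK. Qed.

(** For u in the initial space of w, v preserves the norm of u, and a contraction doing so satisfies
    |u - v^* v u|^2 <= |u|^2 - 2 |v u|^2 + |v u|^2 = 0. *)
Lemma extension_proj v w : pisom w -> bnd 1 v -> v * (adjoint w * w) = w ->
  adjoint v * v * (adjoint w * w) = adjoint w * w.
Proof.
move=> hw bv vw; apply: bopP => x; apply/subr0_eq/rip_eq0.
have vx : v (adjoint w (w x)) = w x.
  by move: (congr1 (fun X : bop H => X x) vw) => /= ->.
have hx : rip (adjoint w (w x)) (adjoint w (w x)) = rip (w x) (w x).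
  by rewrite -adjointP; move: (congr1 (fun X : bop H => X x) hw) => /= ->.
have := bnd_adjoint ler01 bv (w x); rewrite mul1r ler_nrm => h2.
have h3 : rip (adjoint w (w x)) (adjoint v (w x)) = rip (w x) (w x).
  by rewrite -adjointP vx.
rewrite /= vx !ripE hx (ripC (adjoint v (w x)) (adjoint w _)) h3; lra.
Qed.

(** Equality |w P x| = |P x| means that w is isometric on the range of P, which therefore lies in
    the initial space of w. *)
Lemma proj_absorb w P : pisom w -> adjoint P = P ->
  adjoint (w * P) * (w * P) = P * P -> adjoint w * w * P = P.
Proof.
move=> hw sP; rewrite adjointM sP => h.
apply/esym/subr0_eq; rewrite -[X in X - _]mul1r -mulrBl; apply: adjoint_mul_eq0.
rewrite adjointM sP adjointB adjoint1 adjoint_proj mulrA -(mulrA P).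
have -> : (1 - adjoint w * w) * (1 - adjoint w * w) = 1 - adjoint w * w.
  by rewrite mulrBr mulr1 mulrBl mul1r (pisom_proj hw) subrr subr0.
by rewrite mulrBr mulr1 mulrBl -h -!mulrA subrr.
Qed.

(* A chain of partial isometries ordered by extension has its strong limit as an
   upper bound; it is obtained from the union of the graphs. *)
Lemma pisom_chain_bound (C : set (bop H)) :
  C !=set0 -> (forall w, C w -> A w /\ pisom w) ->
  total_on C (fun w v => v * (adjoint w * w) = w) ->
  exists V, [/\ A V, pisom V & forall w, C w -> V * (adjoint w * w) = w].
Proof.
move=> [w0 Cw0] CA tot.
pose D k t := exists w x, [/\ C w, k = adjoint w (w x) & t = w x].
have [||||U [AU U1 U2 bU]] := @vN_adjoint_of_graph _ _ _ hA D 1 ler01.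
- by exists w0, 0; split=> //; rewrite !bop0.
- move=> a _ _ _ _ [w [x [Cw -> ->]]] [w' [x' [Cw' -> ->]]].
  have [[Aw hw] [Aw' hw']] := (CA _ Cw, CA _ Cw').
  have E v y : pisom v -> v (adjoint v (v y)) = v y.
    by move=> hv; exact: (congr1 (fun X : bop H => X y) hv).
  have EX v v' y : pisom v -> pisom v' -> v' * (adjoint v * v) = v ->
      v' (adjoint v (v y)) = v y.
    by move=> hv hv' vv; exact: (congr1 (fun X : bop H => X y) vv).
  have EP v v' y : pisom v -> pisom v' -> v' * (adjoint v * v) = v ->
      adjoint v' (v y) = adjoint v (v y).
    move=> hv hv' vv; rewrite -{1}(EX v v' y) //.
    exact: (congr1 (fun X : bop H => X y)
      (extension_proj hv (pisom_bnd hv') vv)).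
  case: (tot _ _ Cw Cw') => ww.
    exists w', (a *: adjoint w (w x) + x'); split=> //.
      by rewrite !bop_linear EX // EP.
    by rewrite bop_linear EX.
  exists w, (a *: x + adjoint w' (w' x')); split=> //.
    by rewrite !bop_linear EX // EP.
  by rewrite bop_linear EX.
- move=> _ _ [w [x [Cw -> ->]]]; rewrite mul1r ler_nrm -adjointP.
  have [_ hw] := CA _ Cw.
  by move: (congr1 (fun X : bop H => X x) hw) => /= ->.
- move=> S hS _ _ [w [x [Cw -> ->]]]; have [Aw _] := CA _ Cw.
  exists w, (S x); split=> //.
    have := congr1 (fun X : bop H => X x)
      (hS _ (vN_mul hA (vN_adjoint hA Aw) Aw)); exact.
  by have := congr1 (fun X : bop H => X x) (hS _ Aw).
have Vext w : C w -> adjoint U * (adjoint w * w) = w.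
  move=> Cw; have h : adjoint w * w * U = adjoint w.
    apply: bopP => y; apply: rip_inj => z /=; rewrite -adjointP ripC adjointP.
    by rewrite -[RHS]adjointP -(U1 (adjoint w (w z)) (w z)) 1?ripC //; exists w, z.
  by rewrite -[LHS]adjointK adjointM adjointK adjoint_proj h adjointK.
have bV := bnd_adjoint ler01 bU.
exists (adjoint U); split=> //; first exact: vN_adjoint.
have h : (U * adjoint U - 1) * U = 0.
  apply: U2 => _ _ [w [x [Cw -> _]]]; have [_ hw] := CA _ Cw.
  have := extension_proj hw bV (Vext _ Cw); rewrite adjointK => e.
  by have /= -> := congr1 (fun X : bop H => X x) e; rewrite subrr.
rewrite /pisom adjointK; apply: subr0_eq.
rewrite -[RHS]adjoint0 -h adjointM adjointB adjointM adjointK adjoint1.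
by rewrite mulrBr mulr1 mulrA.
Qed.

(** The two vanishing products say that the initial spaces, respectively the final spaces, are
    orthogonal; all cross terms then vanish. *)
Lemma pisom_add w v : pisom w -> pisom v -> v * adjoint w = 0 ->
  adjoint w * v = 0 -> pisom (w + v).
Proof.
move=> hw hv vw wv.
have wv' : w * adjoint v = 0 by rewrite -[LHS]adjointK adjointM adjointK vw adjoint0.
have vw' : adjoint v * w = 0 by rewrite -[LHS]adjointK adjointM adjointK wv adjoint0.
rewrite /pisom adjointD.
have -> : (w + v) * (adjoint w + adjoint v) = w * adjoint w + v * adjoint v.
  by rewrite mulrDl !mulrDr vw wv' addr0 add0r.
by rewrite mulrDl !mulrDr hw hv -!mulrA wv vw' !mulr0 addr0 add0r.
Qed.

(** If both defect projections e = 1 - w^* w and f = 1 - w w^* were nonzero, [factor_prime] would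
    give T in [A] with f T e nonzero; its polar part has initial space under e and final space under
    f, contradicting maximality. *)
Lemma maximal_pisom w :
  A w -> pisom w ->
  (forall v, A v -> pisom v -> v * adjoint w = 0 -> adjoint w * v = 0 -> v = 0) ->
  adjoint w * w = 1 \/ w * adjoint w = 1.
Proof.
move=> Aw hw wmax; have Aw' := vN_adjoint hA Aw.
suff [h|h] : 1 - adjoint w * w = 0 \/ 1 - w * adjoint w = 0.
- by left; apply/esym/subr0_eq.
- by right; apply/esym/subr0_eq.
apply: factor_prime => [|T AT].
  by apply: (vN_sub hA (vN1 hA)); apply: (vN_mul hA).
set f := 1 - _; set e := 1 - _; pose T0 := f * T * e.
have Af : A f by apply: (vN_sub hA (vN1 hA)); apply: (vN_mul hA).
have Ae : A e by apply: (vN_sub hA (vN1 hA)); apply: (vN_mul hA).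
have AT0 : A T0 by apply: vN_mul => //; exact: vN_mul.
have [r r0 bT0] := bnd_exists T0.
have r1 : r + 1 != 0 by rewrite gt_eqF // ltr_wpDl.
pose T1 := ((r + 1)^-1)%:C%C *: T0.
have AT1 : A T1 by exact: vN_scale.
have bT1 : bnd 1 T1.
  apply: bndW (bndZ _ bT0); rewrite ger0_norm ?invr_ge0 ?addr_ge0 //.
  by rewrite mulrC ler_pdivrMr ?mul1r ?lerDl // ltr_wpDl.
have T1w : T1 * adjoint w = 0.
  have ew : e * adjoint w = 0 by rewrite mulrBl mul1r pisom_adjoint // subrr.
  by rewrite /T1 -scale_bopAl /T0 -(mulrA _ e) ew mulr0 scaler0.
have wT1 : adjoint w * T1 = 0.
  have wf : adjoint w * f = 0.
    by rewrite /f mulrBr mulr1 mulrA pisom_adjoint // subrr.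
  by rewrite /T1 -scale_bopAr /T0 !mulrA wf !mul0r scaler0.
have [y [Ay sy _ ey]] := vN_abs hA AT1 bT1.
set P := 1 - y in ey.
have sP : adjoint P = P by rewrite adjointB adjoint1 sy.
have AP : A P by apply: vN_sub => //; exact: vN1.
have [pi [v [Av vv vpi vP [spi dpi]]]] := vN_polar hA AP AT1 sP (esym ey).
have hv : pisom v by rewrite /pisom -mulrA vv.
have Pw : P * adjoint w = 0.
  apply: adjoint_mul_eq0; rewrite adjointM adjointK sP mulrA -(mulrA w) ey.
  by rewrite -!mulrA T1w !mulr0.
have wP : w * P = 0 by rewrite -[LHS]adjointK adjointM sP Pw adjoint0.
have piw : pi * adjoint w = 0.
  by rewrite -[LHS]adjointK adjointM adjointK spi (dpi _ wP) adjoint0.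
have v0 : v = 0.
  apply: wmax => //; first by rewrite -vpi -mulrA piw mulr0.
  by rewrite -vpi mulrA dpi // -mulrA vP.
apply/eqP; move: vP => /esym/eqP; rewrite v0 mul0r /T1 scaler_eq0.
by case/orP=> //; rewrite (inj_eq (@complexI R)) invr_eq0 (negbTE r1).
Qed.

Context (finA : finite_algebra A).

(** Zorn's lemma is applied to the partial isometries w in [A] with w |c| = c, ordered by extension.
    A maximal one is an isometry or a co-isometry by [maximal_pisom], and finiteness, applied to w
    or to its adjoint, makes it unitary. *)
Lemma unitary_polar c : A c -> bnd 1 c ->
  exists w y, [/\ A w, adjoint w * w = 1, w * adjoint w = 1 &
    [/\ A y, adjoint y = y, bnd 1 y & c = w * (1 - y)]].
Proof.
move=> Ac bc; have [y [Ay sy by1 ey]] := vN_abs hA Ac bc.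
pose P := 1 - y.
have sP : adjoint P = P by rewrite adjointB adjoint1 sy.
have AP : A P by apply: vN_sub => //; exact: vN1.
have [pi [w0 [Aw0 vv vpi w0P [spi dpi]]]] := vN_polar hA AP Ac sP (esym ey).
have hw0 : pisom w0 by rewrite /pisom -mulrA vv.
pose good w := [/\ A w, pisom w & w * P = c].
have good_absorb w : good w -> adjoint w * w * P = P.
  by move=> [Aw hw wP]; apply: proj_absorb => //; rewrite wP -ey.
pose T := {w | good w}.
pose Rel (s t : T) := `[< sval t * (adjoint (sval s) * sval s) = sval s >].
have [||s t u|C Ctot|[w [Aw hw wP]] wmax] := @ZL_preorder T _ Rel.
- by exists w0.
- by move=> [w [? hw ?]]; apply/asboolP => /=; rewrite mulrA.
- case: s t u => [w [Aw hw wP]] [v [Av hv vP]] [u [Au hu uP]].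
  move=> /asboolP /= h1 /asboolP /= h2; apply/asboolP => /=.
  by rewrite -(extension_proj hw (pisom_bnd hv) h1) mulrA h2 h1.
(* The empty chain is bounded by the polar part [w0]. *)
- have [C0|/nonemptyPn C0] := pselect (C !=set0); last first.
    by exists (exist _ w0 (And3 Aw0 hw0 w0P)) => s; rewrite C0.
  have [|_ [[w Gw] _ <-]|_ _ [s Cs <-] [t Ct <-]|V [AV hV Vext]] :=
      @pisom_chain_bound [set sval s | s in C].
  + by case: C0 => s Cs; exists (sval s), s.
  + by case: Gw.
  + by case: (Ctot _ _ Cs Ct) => /asboolP; [left | right].
  have VP : V * P = c.
    case: C0 => s Cs; have Gs := svalP s.
    rewrite -(good_absorb _ Gs) mulrA Vext; first by case: Gs.
    by exists s.
  exists (exist _ V (And3 AV hV VP)) => s Cs; apply/asboolP => /=.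
  by apply: Vext; exists s.
have [] := maximal_pisom Aw hw.
- move=> v Av hv vw wv.
  have G : good (w + v).
    split; [exact: vN_add | exact: pisom_add |].
    rewrite mulrDl wP -(good_absorb w) // !mulrA vw !mul0r addr0 //.
  (* Here w + v extends w, so maximality makes w an extension of w + v; the product below reduces to
     w, whence v = 0. *)
  have := wmax (exist _ _ G); rewrite /Rel /= => h.
  have /asboolP : `[< w * (adjoint (w + v) * (w + v)) = w + v >].
    apply: h; apply/asboolP.
    by rewrite mulrDl !mulrA hw vw mul0r addr0.
  rewrite adjointD mulrA.
  have -> : w * (adjoint w + adjoint v) = w * adjoint w.
    rewrite mulrDr -[X in _ + X]adjointK adjointM adjointK vw adjoint0.
    exact: addr0.
  rewrite mulrDr hw -mulrA wv mulr0 addr0 => /eqP.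
  by rewrite -subr_eq0 opprD addrA subrr sub0r oppr_eq0 => /eqP.
- move=> ww; exists w, y; split=> //; exact: finA.
- move=> ww; exists w, y; split=> //.
  by have := finA (vN_adjoint hA Aw); rewrite adjointK; exact.
Qed.

End FiniteFactor.

(** * Two by two operator matrices and their norm *)

Section TwoByTwo.
Context (R : realType) (H : hilbertType R).
Implicit Types (r : R) (a b c d S T : bop H) (M N : 'M[bop H]_2).

Definition mx2 a b c d : 'M[bop H]_2 :=
  \matrix_(i, j) (if i == 0 then if j == 0 then a else b
                  else if j == 0 then c else d).

Lemma mx2_eq M N : M 0 0 = N 0 0 -> M 0 1 = N 0 1 -> M 1 0 = N 1 0 ->
  M 1 1 = N 1 1 -> M = N.
Proof.
move=> h00 h01 h10 h11; apply/matrixP => i j.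
have o2 (k : 'I_2) : k = 0 \/ k = 1.
  by case: k => [[|[|//]] hk]; [left|right]; exact: val_inj.
by case: (o2 i) => ->; case: (o2 j) => ->.
Qed.

(** Bundled in a tuple so that one [rewrite] reads off any entry. *)
Lemma mx2E a b c d : ((mx2 a b c d 0 0 = a) * (mx2 a b c d 0 1 = b) *
  (mx2 a b c d 1 0 = c) * (mx2 a b c d 1 1 = d))%type.
Proof. by rewrite !mxE. Qed.

Lemma mx2K M : mx2 (M 0 0) (M 0 1) (M 1 0) (M 1 1) = M.
Proof. by apply: mx2_eq; rewrite mxE. Qed.

Lemma sum2 (V : zmodType) (F : 'I_2 -> V) : \sum_i F i = F 0 + F 1.
Proof.
rewrite !big_ord_recl big_ord0 addr0; congr (_ + F _).
exact: val_inj.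
Qed.

Lemma mulmx2 a b c d a' b' c' d' : mx2 a b c d *m mx2 a' b' c' d' =
  mx2 (a * a' + b * c') (a * b' + b * d') (c * a' + d * c') (c * b' + d * d').
Proof. by apply: mx2_eq; rewrite mxE sum2 !mxE. Qed.

Lemma submx2 a b c d a' b' c' d' : mx2 a b c d - mx2 a' b' c' d' =
  mx2 (a - a') (b - b') (c - c') (d - d').
Proof. by apply: mx2_eq; rewrite !mxE. Qed.

Lemma mxadjoint2 a b c d : mxadjoint (mx2 a b c d) =
  mx2 (adjoint a) (adjoint c) (adjoint b) (adjoint d).
Proof. by apply: mx2_eq; rewrite !mxE. Qed.

Lemma scalar_mx2 : 1%:M = mx2 1 0 0 1.
Proof. by apply: mx2_eq; rewrite !mxE. Qed.

Lemma p0_mx2 : p0 = mx2 1 0 0 0.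
Proof. by apply: mx2_eq; rewrite !mxE. Qed.

Lemma matrix_algebra2 (A : set (bop H)) a b c d :
  A a -> A b -> A c -> A d -> matrix_algebra A (mx2 a b c d).
Proof. by move=> ha hb hc hd i j; rewrite mxE; do 2 case: ifP => _. Qed.

Definition dsvec (x y : H) (i : 'I_2) : H := if i == 0 then x else y.

Lemma dsvecK (X : 'I_2 -> H) : dsvec (X 0) (X 1) = X.
Proof.
apply/funext => -[[|[|//]] hk]; rewrite /dsvec /=; congr X; exact: val_inj.
Qed.

Lemma dsnorm2 x y : dsnorm (dsvec x y) = Num.sqrt (rip x x + rip y y).
Proof. by rewrite /dsnorm sum2 /dsvec /= -!/(nrm _) !nrm_sqr. Qed.

Lemma mxact2 a b c d x y : mxact (mx2 a b c d) (dsvec x y) =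
  dsvec (a x + b y) (c x + d y).
Proof.
apply/funext => i; rewrite /mxact sum2 !mxE /dsvec /=.
by case: ifP.
Qed.

Lemma dsnorm_ge0 n (X : 'I_n -> H) : 0 <= dsnorm X.
Proof. exact: sqrtr_ge0. Qed.

Lemma mxopnorm_le M r : 0 <= r ->
  (forall X, dsnorm (mxact M X) <= r * dsnorm X) -> mxopnorm M <= r.
Proof.
move=> r0 h; apply: ge_sup.
  exists (dsnorm (mxact M (dsvec 0 0))), (dsvec 0 0) => //=.
  by rewrite dsnorm2 !rip0l addr0 sqrtr0 ler01.
move=> _ [X /= X1 <-]; apply: le_trans (h X) _.
by rewrite -[leRHS]mulr1 ler_wpM2l.
Qed.

(** Each component has square norm at most r^2 (|x| + |y|)^2 <= 2 r^2 (|x|^2 + |y|^2); the two rows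
    together give the factor (2 r)^2. *)
Lemma mxact_bnd a b c d r : 0 <= r -> bnd r a -> bnd r b -> bnd r c -> bnd r d ->
  forall X, dsnorm (mxact (mx2 a b c d) X) <= 2 * r * dsnorm X.
Proof.
move=> r0 ha hb hc hd X; rewrite -(dsvecK X) mxact2 !dsnorm2.
set x := X 0; set y := X 1.
have aux S T : bnd r S -> bnd r T ->
    rip (S x + T y) (S x + T y) <= 2 * r ^+ 2 * (rip x x + rip y y).
  move=> hS hT; rewrite -!nrm_sqr.
  have h1 : nrm (S x + T y) <= r * (nrm x + nrm y).
    by rewrite mulrDr; apply: le_trans (nrmD _ _) (lerD (hS x) (hT y)).
  have h2 : nrm (S x + T y) ^+ 2 <= (r * (nrm x + nrm y)) ^+ 2.
    rewrite ler_pXn2r // ?nnegrE ?nrm_ge0 //.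
    by rewrite mulr_ge0 // addr_ge0 ?nrm_ge0.
  apply: le_trans h2 _.
  have := sqr_ge0 (r * (nrm x - nrm y)); move: (nrm x) (nrm y) => p q.
  by clear; nra.
have r20 : 0 <= 2 * r by rewrite mulr_ge0.
rewrite -[2 * r](ger0_norm r20) -sqrtr_sqr -sqrtrM ?sqr_ge0 //.
apply: ler_wsqrtr; apply: le_trans (lerD (aux _ _ ha hb) (aux _ _ hc hd)) _.
by rewrite le_eqVlt; apply/orP; left; apply/eqP; ring.
Qed.

Lemma le_mxopnorm M X : dsnorm (mxact M X) <= mxopnorm M * dsnorm X.
Proof.
have [C C0 hC] : exists2 C, 0 <= C &
    forall X, dsnorm (mxact M X) <= C * dsnorm X.
  rewrite -(mx2K M).
  have [ra ra0 ha] := bnd_exists (M 0 0); have [rb rb0 hb] := bnd_exists (M 0 1).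
  have [rc rc0 hc] := bnd_exists (M 1 0); have [rd rd0 hd] := bnd_exists (M 1 1).
  exists (2 * (ra + rb + rc + rd)); first by rewrite mulr_ge0 ?addr_ge0.
  apply: mxact_bnd; first by rewrite ?addr_ge0.
  - by apply: bndW ha; lra.
  - by apply: bndW hb; lra.
  - by apply: bndW hc; lra.
  - by apply: bndW hd; lra.
have scale r Y : 0 <= r ->
    dsnorm (fun i => r%:C%C *: Y i : H) = r * dsnorm (Y : 'I_2 -> H).
  move=> r0; rewrite -(dsvecK Y) -[in LHS](dsvecK (fun i => _)) !dsnorm2 /dsvec /=.
  rewrite !ripE -[r in RHS](ger0_norm r0) -sqrtr_sqr -sqrtrM ?sqr_ge0 //.
  by congr Num.sqrt; ring.
have act r Y : mxact M (fun i => r%:C%C *: Y i : H) =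
    (fun i => r%:C%C *: mxact M Y i).
  by apply/funext => i; rewrite /mxact !sum2 !bop_scale scalerDr.
have [X0|X0] := eqVneq (dsnorm X) 0.
  by rewrite X0 mulr0; have := hC X; rewrite X0 mulr0.
have Xp : 0 < dsnorm X by rewrite lt_def X0 dsnorm_ge0.
have dV : 0 <= (dsnorm X)^-1 by rewrite invr_ge0 ltW.
rewrite -ler_pdivrMr // mulrC -scale // -act.
apply: ub_le_sup.
  exists C => _ [Y /= Y1 <-]; apply: le_trans (hC Y) _.
  by rewrite -[leRHS]mulr1 ler_wpM2l.
by exists (fun i => ((dsnorm X)^-1)%:C%C *: X i) => //=; rewrite scale // mulVf.
Qed.

End TwoByTwo.

(** * Projections near [p0] belong to the sphere *)

Section RiemannSphere.
Context (R : realType) (H : hilbertType R) (A : set (bop H)).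
Context (hA : von_neumann_algebra A).
Implicit Types (r : R) (a b c d S T : bop H) (q : 'M[bop H]_2).

Lemma bop_at S T : S = T -> forall x, S x = T x.
Proof. by move=> ->. Qed.

Lemma nrm_sqrt (x : H) : nrm x = Num.sqrt (rip x x).
Proof. by rewrite -nrm_sqr sqrtr_sqr ger0_norm ?nrm_ge0. Qed.

(** With g = 1 - y one has |g| <= 2 and (1 - r) |x| <= |g (g x)| <= 2 |g x|, so g has an inverse of
    norm at most 2 / (1 - r). *)
Lemma vN_sqrt_unit T r : A T -> adjoint T = T -> r < 1 -> bnd r (1 - T) ->
  exists g gi, [/\ A g, A gi, adjoint g = g, adjoint gi = gi &
    [/\ g * g = T, g * gi = 1 & gi * g = 1]].
Proof.
move=> AT sT r1 bT.
have [|||y [Ay sy by1 ey]] := @vN_sqrt_one_sub _ _ _ hA (1 - T).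
- by apply: (vN_sub hA) => //; exact: vN1.
- by rewrite adjointB adjoint1 sT.
- by apply: bndW bT; exact: ltW.
pose g := 1 - y.
have bg : bnd (1 + 1) g by apply: bndB => //; exact: bnd1.
have sg : adjoint g = g by rewrite adjointB adjoint1 sy.
have gg : g * g = T by rewrite ey opprB addrC subrK.
have Ag : A g by apply: (vN_sub hA) => //; exact: vN1.
have [|x|gi [ggi gig sgi _]] := @selfadjoint_inverse _ _ g (2 / (1 - r)) _ sg.
- by rewrite divr_ge0 // subr_ge0 ltW.
- have h1 := bT x; rewrite /= -(bop_at gg x) /= in h1.
  have h2 := bg (g x).
  have h3 := nrmD (x - g (g x)) (g (g x)); rewrite subrK in h3.
  rewrite mulrAC ler_pdivlMr ?subr_gt0 //; lra.
exists g, gi; split=> //; exact: (vN_inverse hA Ag ggi gig).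
Qed.

Lemma close_projection_in_sphere q :
  mxprojection A q -> mxopnorm (q - p0) < 1 -> riemann_sphere A q.
Proof.
rewrite -(mx2K q); move: (q 0 0) (q 0 1) (q 1 0) (q 1 1) => a b c d.
move=> [Aq qq sq] hq; move: qq sq; rewrite mulmx2 mxadjoint2 => qq sq.
have := congr1 (fun M : 'M[bop H]_2 => M 0 0) qq; rewrite !mx2E => e00.
have := congr1 (fun M : 'M[bop H]_2 => M 0 1) qq; rewrite !mx2E => e01.
have := congr1 (fun M : 'M[bop H]_2 => M 1 0) qq; rewrite !mx2E => e10.
have := congr1 (fun M : 'M[bop H]_2 => M 1 1) qq; rewrite !mx2E => e11.
have := congr1 (fun M : 'M[bop H]_2 => M 0 0) sq; rewrite !mx2E => sa.
have := congr1 (fun M : 'M[bop H]_2 => M 0 1) sq; rewrite !mx2E => sc.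
have := congr1 (fun M : 'M[bop H]_2 => M 1 0) sq; rewrite !mx2E => sb.
have := congr1 (fun M : 'M[bop H]_2 => M 1 1) sq; rewrite !mx2E => sd.
have Aa : A a by have := Aq 0 0; rewrite mx2E.
have Ab : A b by have := Aq 0 1; rewrite mx2E.
have Ac : A c by have := Aq 1 0; rewrite mx2E.
have Ad : A d by have := Aq 1 1; rewrite mx2E.
move: hq; set r := mxopnorm _ => r1.
have key x y : Num.sqrt (rip ((a - 1) x + b y) ((a - 1) x + b y) +
    rip (c x + d y) (c x + d y)) <= r * Num.sqrt (rip x x + rip y y).
  rewrite -!dsnorm2; apply: le_trans (le_mxopnorm _ _).
  by rewrite p0_mx2 submx2 !subr0 mxact2.
(* Testing on (x, 0) bounds 1 - a; testing on (0, x) bounds d. *)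
have ba : bnd r (1 - a).
  move=> x; have := key x 0; rewrite !bop0 !addr0 rip0l addr0 -nrm_sqrt.
  apply: le_trans; rewrite nrm_sqrt; apply: ler_wsqrtr.
  by rewrite /= -(opprB x) ripNl ripNr opprK lerDl rip_ge0.
have bd : bnd r (1 - (1 - d)).
  move=> x; have := key 0 x; rewrite !bop0 !add0r rip0l add0r -nrm_sqrt.
  apply: le_trans; rewrite nrm_sqrt; apply: ler_wsqrtr.
  by rewrite /= opprB addrC subrK lerDr rip_ge0.
have [g [gi [Ag Agi sg sgi [/bop_at gg /bop_at ggi /bop_at gig]]]] :=
  vN_sqrt_unit Aa sa r1 ba.
have [||h [hi [Ah Ahi sh shi [/bop_at hh /bop_at hhi /bop_at hih]]]] :=
  vN_sqrt_unit _ _ r1 bd.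
- by apply: (vN_sub hA) => //; exact: vN1.
- by rewrite adjointB adjoint1 sd.
rewrite /= in gg ggi gig hh hhi hih.
move/bop_at: e00 => /= e00; move/bop_at: e01 => /= e01.
move/bop_at: e10 => /= e10; move/bop_at: e11 => /= e11.
have bc x : b (c x) = a x - a (a x).
  by apply/esym/eqP; rewrite subr_eq addrC e00.
have cb x : c (b x) = d x - d (d x).
  by apply/esym/eqP; rewrite subr_eq e11.
(* Idempotence gives b (1 - d) = a b, so b intertwines h^2 with g^2, and c intertwines g^2 with h^2;
   the same holds for the inverses. These relations replace commutativity in the check of
   unitarity. *)
have k0 x : b (h (h x)) = g (g (b x)).
  by apply/eqP; rewrite hh gg bopB subr_eq e01.
have k0' x : h (h (c x)) = c (g (g x)).
  by apply/eqP; rewrite hh gg subr_eq e10.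
have k1 x : gi (gi (b x)) = b (hi (hi x)).
  by rewrite -[x in LHS]hhi -[hi x in LHS]hhi k0 !gig.
have k2 x : hi (hi (c x)) = c (gi (gi x)).
  by rewrite -[x in LHS]ggi -[gi x in LHS]ggi -k0' !hih.
have cd x : c (gi (gi (b x))) = d x.
  by rewrite k1 cb -bopB -hh !hhi.
have k3 x : gi (b (h x)) = g (b (hi x)) by rewrite -[LHS]ggi k1 hih.
have k3' x : h (c (gi x)) = hi (c (g x)) by rewrite -[RHS]hhi k2 gig.
have hd x : d x = x - h (h x) by rewrite hh opprB addrC subrK.
exists (mx2 g (- (b * hi)) (c * gi) h); last first.
  rewrite mxadjoint2 p0_mx2 !mulmx2 sg sh adjointN !adjointM shi sgi sb sc.
  rewrite ?(mulr0, mul0r, addr0, mulr1).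
  apply: mx2_eq; rewrite !mx2E //; apply: bopP => x /=.
  - exact: gg.
  - exact: ggi.
  - by rewrite gig.
  - exact: cd.
split.
- apply: matrix_algebra2 => //; first by apply: (vN_opp hA); exact: vN_mul.
  exact: vN_mul.
- rewrite mxadjoint2 mulmx2 scalar_mx2 sg sh adjointN !adjointM shi sgi sb sc.
  apply: mx2_eq; rewrite !mx2E; apply: bopP => x /=.
  + by rewrite bc !bopB -!gg !ggi !gig addrC subrK.
  + by rewrite bopN k3 addNr.
  + by rewrite k3' addNr.
  + by rewrite !bopN opprK cb -bopB -hh hhi hd bopB !hih subrK.
- rewrite mxadjoint2 mulmx2 scalar_mx2 sg sh adjointN !adjointM shi sgi sb sc.
  apply: mx2_eq; rewrite !mx2E; apply: bopP => x /=.
  + by rewrite !bopN opprK -k1 bc !bopB -!gg !gig addrC subrK.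
  + by rewrite ggi hih subrr.
  + by rewrite gig bopN hhi subrr.
  + by rewrite cd hh addrC subrK.
Qed.

End RiemannSphere.

(** * Approximation of points of the sphere *)

Section Density.
Context (R : realType) (H : hilbertType R).
Implicit Types (r : R) (a b c d s S T X Y n : bop H).

(** For a projection q, the square of q - p0 is diagonal with entries 1 - a and d, so the distance
    to [p0] is governed by two corner estimates. *)
Lemma dsnorm_sub_p0 a b c d (x y : H) :
  mx2 a b c d *m mx2 a b c d = mx2 a b c d ->
  mxadjoint (mx2 a b c d) = mx2 a b c d ->
  dsnorm (mxact (mx2 a b c d - p0) (dsvec x y)) =
    Num.sqrt (rip x x - rip (a x) x + rip (d y) y).
Proof.
rewrite mulmx2 mxadjoint2 => qq sq.
have := congr1 (fun M : 'M[bop H]_2 => M 0 0) qq.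
have := congr1 (fun M : 'M[bop H]_2 => M 0 1) qq.
have := congr1 (fun M : 'M[bop H]_2 => M 1 1) qq.
have := congr1 (fun M : 'M[bop H]_2 => M 0 0) sq.
have := congr1 (fun M : 'M[bop H]_2 => M 0 1) sq.
have := congr1 (fun M : 'M[bop H]_2 => M 1 1) sq.
rewrite !mx2E => sd sc sa /bop_at /= e11 /bop_at /= e01 /bop_at /= e00.
have sb : adjoint b = c by rewrite -sc adjointK.
have E00 : rip (a x) (a x) + rip (c x) (c x) = rip (a x) x.
  by rewrite (adjointP a) (adjointP c) sa sc -ripDr e00 ripC.
have E11 : rip (b y) (b y) + rip (d y) (d y) = rip (d y) y.
  by rewrite (adjointP b) (adjointP d) sb sd -ripDr e11 ripC.
have E01 : rip (a x) (b y) + rip (c x) (d y) = rip x (b y).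
  by rewrite (adjointP a) (adjointP c) sa sc -ripDr e01.
rewrite p0_mx2 submx2 !subr0 mxact2 dsnorm2 /=; congr Num.sqrt.
rewrite !ripE (ripC x (a x)) (ripC (b y) (a x)) (ripC (b y) x).
rewrite (ripC (d y) (c x)); lra.
Qed.

(** The difference telescopes into X' (n - 1) Y' + (X' - X) Y' + X (Y' - Y); the bounds add up to 20
    r + 2 r + r. *)
Lemma bnd_sandwich r X X' Y Y' n :
  0 <= r -> bnd r (X' - X) -> bnd r (Y' - Y) -> bnd (5 * r) (n - 1) ->
  bnd 2 X' -> bnd 2 Y' -> bnd 1 X ->
  bnd (23 * r) (X' * n * Y' - X * Y).
Proof.
move=> r0 hX hY hn bX' bY' bX.
have -> : X' * n * Y' - X * Y =
    X' * (n - 1) * Y' + ((X' - X) * Y' + X * (Y' - Y)) by bop_ring.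
have -> : 23 * r = 2 * (5 * r) * 2 + (r * 2 + 1 * r) by ring.
have r5 : 0 <= 5 * r by rewrite mulr_ge0.
apply: bndD; last by apply: bndD; apply: bndM.
by apply: bndM => //; [rewrite mulr_ge0 | apply: bndM].
Qed.

(** With D = k^2 + t^2, the hypotheses give (1 + r^2) t^2 <= D and D^2 <= t^2 z^2, hence (1 + r^2) D
    <= z^2. The weaker constant 1 - r^2 / 36 >= 1 / (1 + r^2) is chosen to match the other
    corner. *)
Lemma quad_bound r (k t z : R) : 0 < r <= 1 -> k ^+ 2 + t ^+ 2 <= t * z ->
  r * t <= k -> 0 <= t -> 0 <= k -> 0 <= z ->
  k ^+ 2 + t ^+ 2 <= (1 - r ^+ 2 / 36) * z ^+ 2.
Proof.
move=> /andP[r0 r1] h rtk t0 k0 z0; pose D := k ^+ 2 + t ^+ 2.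
have r21 : 0 < 1 + r ^+ 2 by rewrite ltr_wpDr // sqr_ge0.
have D0 : 0 <= D by rewrite addr_ge0 // sqr_ge0.
have h1 : (1 + r ^+ 2) * t ^+ 2 <= D.
  have : (r * t) ^+ 2 <= k ^+ 2.
    by rewrite ler_pXn2r // nnegrE // mulr_ge0 // ltW.
  rewrite /D exprMn; lra.
have h2 : D ^+ 2 <= t ^+ 2 * z ^+ 2.
  by rewrite -exprMn ler_pXn2r // nnegrE // mulr_ge0.
have h3 : (1 + r ^+ 2) * D <= z ^+ 2.
  have [D1|D1] := eqVneq D 0; first by rewrite D1 mulr0 sqr_ge0.
  have Dp : 0 < D by rewrite lt_def D1.
  rewrite -(ler_pM2r Dp) -mulrA -expr2.
  apply: le_trans (ler_wpM2l (ltW r21) h2) _.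
  by rewrite mulrA [leRHS]mulrC ler_wpM2r // sqr_ge0.
rewrite -/D -(ler_pM2l r21); apply: le_trans h3 _.
have : 0 <= r ^+ 2 <= 1 by rewrite sqr_ge0 expr_le1 // ltW.
move: (r ^+ 2) (z ^+ 2) (sqr_ge0 z) => p q q0 /andP[p0 p1].
rewrite mulrA -[leLHS]mul1r ler_wpM2r //; nra.
Qed.

Context (A : set (bop H)) (fA : von_neumann_factor A) (finA : finite_algebra A).

Let hA : von_neumann_algebra A := fA.1.

(* Perturbing the polar part |c| = 1 - y of the corner [c] to |c| + r makes the
   corner invertible; [n] renormalises the perturbed column to an isometry. *)
Lemma column_approx c s r : A c -> A s -> adjoint c * c + adjoint s * s = 1 ->
  0 < r <= 1 ->
  exists q, [/\ mxprojection A q, mxopnorm (q - p0) < 1 &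
    mxopnorm (q - mx2 (c * adjoint c) (c * adjoint s)
                      (s * adjoint c) (s * adjoint s)) <= 46 * r].
Proof.
move=> Ac As cs /andP[r0 r1]; have r0' := ltW r0.
have r01 : 0 < r <= 1 by rewrite r0.
have csx x : rip (c x) (c x) + rip (s x) (s x) = rip x x.
  by rewrite !adjointP -ripDr; have /= -> := bop_at cs x.
have bc : bnd 1 c.
  by move=> x; rewrite mul1r ler_nrm -(csx x) lerDl rip_ge0.
have bs : bnd 1 s.
  by move=> x; rewrite mul1r ler_nrm -(csx x) lerDr rip_ge0.
have [w [y [Aw ww ww' [Ay sy by1 cE]]]] := unitary_polar fA finA Ac bc.
have bw := bnd_isometry ww.
pose P : bop H := 1 - y.
have sP : adjoint P = P by rewrite adjointB adjoint1 sy.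
have bP : bnd 2 P by have := bndB (@bnd1 R H) by1.
have P0 x : 0 <= rip (P x) x.
  rewrite /P /= ripDl ripNl subr_ge0; apply: le_trans (rip_le _ _) _.
  rewrite -nrm_sqr expr2 ler_wpM2r ?nrm_ge0 //.
  by have := by1 x; rewrite mul1r.
pose rC : R[i] := r%:C%C.
pose Q := P + rC *: (1 : bop H).
have sQ : adjoint Q = Q by rewrite adjointD sP adjointZ adjoint1 conjc_real.
have Qlow x : r * nrm x <= nrm (Q x).
  have -> : Q x = (1 + r)%:C%C *: x - y x.
    by rewrite /Q /P /= rmorphD scalerDl scale1r addrAC.
  have := nrmD ((1 + r)%:C%C *: x - y x) (y x); rewrite subrK nrmZr.
  have := by1 x; rewrite ger0_norm ?addr_ge0 //; lra.
pose ce := w * Q.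
have Ace : A ce.
  apply: (vN_mul hA) => //; apply: (vN_add hA).
    by apply: (vN_sub hA) => //; exact: vN1.
  by apply: (vN_scale hA); exact: vN1.
have ceD : ce - c = rC *: w.
  by rewrite /ce cE -/P /Q mulrDr addrC addKr -scale_bopAr mulr1.
have bceD : bnd r (ce - c).
  by rewrite ceD; have := bndZ r bw; rewrite ger0_norm // mulr1.
have bceD' : bnd r (adjoint ce - adjoint c).
  by rewrite -adjointB; apply: bnd_adjoint => //.
have bce : bnd 2 ce.
  by rewrite -[ce](subrK c); apply: bndW (bndD bceD bc); lra.
have bce' : bnd 2 (adjoint ce) by apply: bnd_adjoint.
have bs' : bnd 1 (adjoint s) by apply: bnd_adjoint.
(* The perturbed corner is bounded below together with its adjoint, because w is unitary; both
   bounds enter the norm estimate. *)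
have celow x : r * nrm x <= nrm (ce x).
  apply: le_trans (Qlow x) _; rewrite ler_nrm /ce /= (adjointP w).
  by have /= -> := bop_at ww (Q x).
have celow' x : r * nrm x <= nrm (adjoint ce x).
  rewrite /ce adjointM sQ; apply: le_trans (Qlow (adjoint w x)).
  rewrite ler_wpM2l // ler_nrm -(adjointP w).
  by have /= -> := bop_at ww' x.
pose m := adjoint ce * ce + adjoint s * s.
have sm : adjoint m = m by rewrite adjointD !adjoint_proj.
have Am : A m.
  by apply: (vN_add hA); apply: (vN_mul hA) => //; exact: vN_adjoint.
(* As w is an isometry, m - 1 = (|c| + r)^2 - |c|^2 = 2 r |c| + r^2. This is positive, so m >= 1,
   and at most 5 r in norm. *)
have mE : m - 1 = (2 * r)%:C%C *: P + (r ^+ 2)%:C%C *: (1 : bop H).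
  have -> : m = Q * Q + (1 - P * P).
    have -> : 1 - P * P = adjoint s * s.
      rewrite -cs cE adjointM sP -mulrA (mulrA _ w) ww mul1r.
      by rewrite addrC addrA addNr add0r.
    by rewrite /m /ce adjointM sQ -mulrA (mulrA _ w) ww mul1r.
  rewrite /Q /rC; bop_ring.
clearbody ce; clearbody Q; clearbody P.
have bm1 : bnd (5 * r) (m - 1).
  rewrite mE; have := bndD (bndZ (2 * r) bP) (bndZ (r ^+ 2) (@bnd1 R H)).
  apply: bndW; rewrite !ger0_norm ?mulr_ge0 ?sqr_ge0 //; nra.
have mpos x : rip x x <= rip (m x) x.
  rewrite -[m x](subrK x) ripDl lerDr -[x in X in _ - X]/((1 : bop H) x).
  have /= -> := bop_at mE x.
  rewrite ripDl !ripZl; apply: addr_ge0; apply: mulr_ge0.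
  - exact: mulr_ge0.
  - exact: P0.
  - exact: sqr_ge0.
  - exact: rip_ge0.
have mlow x : nrm x <= 1 * nrm (m x).
  have h := le_trans (mpos x) (rip_le _ _); rewrite -nrm_sqr expr2 in h.
  rewrite mul1r; have [->|x0] := eqVneq (nrm x) 0; first exact: nrm_ge0.
  have xp : 0 < nrm x by rewrite lt_def x0 nrm_ge0.
  by rewrite -(ler_pM2r xp).
have mup x : nrm (m x) <= 6 * nrm x.
  have -> : m = (m - 1) + 1 by rewrite subrK.
  by apply: bndW (bndD bm1 (@bnd1 R H)) x; lra.
have [n [mn nm sn bn]] := selfadjoint_inverse ler01 sm mlow.
have An : A n := vN_inverse hA Am mn nm.
have mnx x : m (n x) = x := bop_at mn x.
have bn1 : bnd (5 * r) (n - 1).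
  have -> : n - 1 = - (n * (m - 1)).
    by rewrite mulrBr nm mulr1 opprB.
  by apply: bndN; rewrite -[5 * r]mul1r; apply: bndM.
(* The projection onto the range of the column (ce, s), with n the inverse of its Gram operator
   m. *)
pose q := mx2 (ce * n * adjoint ce) (ce * n * adjoint s)
              (s * n * adjoint ce) (s * n * adjoint s).
have Aq : matrix_algebra A q.
  by apply: matrix_algebra2; apply: (vN_mul hA) => //;
    try (exact: vN_adjoint); exact: (vN_mul hA).
have qq : q *m q = q.
  have nmn X Y : X * n * adjoint ce * (ce * n * Y) +
      X * n * adjoint s * (s * n * Y) = X * n * Y.
    transitivity (X * (n * m) * n * Y); last by rewrite nm mulr1.
    by rewrite /m mulrDr mulrDr !mulrDl !mulrA.
  by rewrite /q mulmx2 !nmn.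
have sq : mxadjoint q = q.
  by rewrite /q mxadjoint2 !adjointM !adjointK !sn !mulrA.
exists q; split; first by split.
  (* Here 36 = 6^2, where 6 is the norm bound on m. *)
  pose rho := 1 - r ^+ 2 / 36.
  have rho0 : 0 <= rho by rewrite /rho; nra.
  apply: (@le_lt_trans _ _ (Num.sqrt rho)); last first.
    rewrite -[ltRHS]sqrtr1 ltr_sqrt // /rho.
    by rewrite ltrBlDr ltrDl divr_gt0 // exprn_gt0.
  apply: mxopnorm_le => [|X]; first exact: sqrtr_ge0.
  rewrite -(dsvecK X) dsnorm_sub_p0 // dsnorm2 -sqrtrM //.
  apply: ler_wsqrtr; move: (X 0) (X 1) => x z.
  (* First corner: with u = n (ce^* x), <a x, x> = <m u, u> >= |u|^2, and r |x| <= |m u| <= 6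
     |u|. *)
  have ha : (r / 6) ^+ 2 * rip x x <= rip ((ce * n * adjoint ce) x) x.
    rewrite /= (adjointP ce) ripC; set v := adjoint ce x; set u := n v.
    have vu : v = m u by rewrite /u mnx.
    have h1 : r * nrm x <= 6 * nrm u.
      by apply: le_trans (celow' x) _; rewrite -/v vu.
    rewrite vu; apply: le_trans (mpos u).
    rewrite -!nrm_sqr -exprMn ler_pXn2r ?nnegrE ?nrm_ge0 //; first by lra.
    by rewrite mulr_ge0 ?nrm_ge0 // divr_ge0.
  (* Second corner: for u = n (s^* z), <d z, z> = <s u, z> = |ce u|^2 + |s u|^2, which is the
     setting of [quad_bound]. *)
  have hd : rip ((s * n * adjoint s) z) z <= rho * rip z z.
    rewrite /=; set v := adjoint s z; set u := n v.
    have vu : v = m u by rewrite /u mnx.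
    have h1 : rip (s u) z = rip (ce u) (ce u) + rip (s u) (s u).
      by rewrite adjointP -/v vu /m /= ripDr -!adjointP.
    have h2 := rip_le (s u) z.
    have h3 : r * nrm (s u) <= nrm (ce u).
      apply: le_trans (celow u); rewrite ler_wpM2l //.
      by have := bs u; rewrite mul1r.
    rewrite -!nrm_sqr in h1 *; rewrite h1 in h2 *.
    move: (r01) h2 h3 (nrm_ge0 (s u)) (nrm_ge0 (ce u)) (nrm_ge0 z).
    exact: quad_bound.
  rewrite mulrDr lerD // /rho mulrBl mul1r lerD2l lerN2.
  by apply: le_trans ha; rewrite le_eqVlt; apply/orP; left; apply/eqP; field.
apply: mxopnorm_le => [|X]; first by rewrite mulr_ge0.
(* The entrywise bound 23 r of [bnd_sandwich] is doubled by [mxact_bnd]. *)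
rewrite /q submx2 (_ : 46 * r = 2 * (23 * r)); last by ring.
have bs2 : bnd 2 s by apply: bndW bs; lra.
have bs2' : bnd 2 (adjoint s) by apply: bndW bs'; lra.
have b0 : bnd r (0 : bop H) by apply: bndW r0' _; exact: bnd0.
apply: mxact_bnd; first by rewrite mulr_ge0.
all: by apply: bnd_sandwich; rewrite ?subrr.
Qed.
End Density.

(** * Inclusion in the sphere and density of the open ball around [p0] *)

Theorem mainTheorem17 (R : realType) (H : hilbertType R) (A : set (bop H)) :
  von_neumann_factor A -> finite_algebra A ->
  norm_dense_in [set q | mxprojection A q /\ mxopnorm (q - p0) < 1]
    (riemann_sphere A).
Proof.
move=> fA finA; split=> [q [Aq hq]|_ [u [Au uu uu'] <-] e e0].
  exact: close_projection_in_sphere fA.1 _ Aq hq.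
have cs : adjoint (u 0 0) * u 0 0 + adjoint (u 1 0) * u 1 0 = 1.
  have := congr1 (fun M : 'M[bop H]_2 => M 0 0) uu.
  by rewrite -{1 2}(mx2K u) mxadjoint2 mulmx2 scalar_mx2 !mx2E.
(* [column_approx] gives distance at most 46 r; dividing by 47 makes the inequality strict. *)
pose r := Num.min 1 (e / 47).
have r0 : 0 < r by rewrite lt_min ltr01 divr_gt0.
have re : 47 * r <= e by rewrite mulrC -ler_pdivlMr // ge_min lexx orbT.
have [|q [Aq hq1 hq2]] := @column_approx _ _ _ fA finA _ _ r (Au 0 0) (Au 1 0) cs.
  by rewrite r0 ge_min lexx.
exists q => //.
(* The product u p0 u^* involves only the first column of u. *)
rewrite -(mx2K u) mxadjoint2 p0_mx2 !mulmx2.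
rewrite ?(mulr0, mul0r, addr0, mulr1); apply: le_lt_trans hq2 _; lra.
Qed.
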